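(* Let $G$ be a connected $d$-regular vertex-transitive graph on $n$ vertices with $d=\omega(\log^3 n\,\log\log n)$. Then $G$ contains a cycle of length $(1-o(1))n$.
   Context: All graphs are finite and simple. A graph is vertex-transitive if for any two vertices there is an automorphism mapping one to the other. Asymptotic notation is with respect to $n\to\infty$: $d=\omega(f(n))$ means $d/f(n)\to\infty$, and $\log^3 n=(\log n)^3$. The conclusion means: for every $\delta>0$ and all sufficiently large $n$ (depending only on $\delta$ and on the rate of divergence in the hypothesis), $G$ contains a cycle of length at least $(1-\delta)n$. *)

(* Defs.v *)
From HB Require Import structures.
From mathcomp Require Import all_boot all_order all_algebra perm.
From mathcomp Require Import all_classical all_reals all_analysis.

Set Implicit Arguments.
Unset Strict Implicit.
Unset Printing Implicit Defensive.

Import Order.TTheory GRing.Theory Num.Theory.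
Import numFieldNormedType.Exports.

Local Open Scope classical_set_scope.
Local Open Scope ring_scope.

Section Graph.
Variables (T : finType) (e : rel T).

Definition simple_graph : Prop := symmetric e /\ irreflexive e.

Definition connected_graph : Prop := forall x y : T, connect e x y.

Definition regular_graph (d : nat) : Prop :=
  forall x : T, #|[set y | e x y]%SET| = d.

Definition automorphism (s : {perm T}) : Prop :=
  forall x y : T, e (s x) (s y) = e x y.

Definition vertex_transitive : Prop :=
  forall x y : T, exists s : {perm T}, automorphism s /\ s x = y.

(* [ucycle e [:: x]] can only hold when [e x x], but [ucycle e [::]] always
   holds and [ucycle e [:: x; y]] holds for every edge of a symmetric [e];
   the size bound leaves exactly the cycles of the graph. *)
Definition graph_cycle (c : seq T) : Prop := ucycle e c /\ (3 <= size c)%N.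

End Graph.

(* [f = omega(g)]. Finitely many values of [g] may vanish or be negative
   without any effect on the limit. *)
Definition little_omega (R : realType) (f g : nat -> R) : Prop :=
  f n / g n @[n --> \oo] --> +oo.

(* Main.v *)
Require Import Defs.
From HB Require Import structures.
From mathcomp Require Import all_boot all_order all_algebra perm.
From mathcomp Require Import all_classical all_reals all_analysis.
From mathcomp Require Import zify ring lra.
Import mathcomp.boot.fintype mathcomp.boot.finset mathcomp.boot.bigop.

Set Implicit Arguments.
Unset Strict Implicit.
Unset Printing Implicit Defensive.

Import Order.TTheory GRing.Theory Num.Theory.
Import numFieldNormedType.Exports.

Local Open Scope ring_scope.

(** Why a vertex-transitive graph of degree [d >> ln^3 n] has an almost spanning
    cycle.

    The cycle is threaded along a prepared ladder.  A ladder consists of two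
    disjoint long paths, the rail of the feet [a_1, ..., a_N] and the rail of the
    tops [b_1, ..., b_N], the second one closed into a cycle, with a rung
    [a_i b_i] at every position.  Suppose that the rest of the graph is almost
    covered by disjoint paths, called chords, whose ends are adjacent to distinct
    feet.  The ladder is swept from left to right, the current path following the
    top rail.  When the leftmost pending end sits at [a_i], the foot rail carries
    it to [a_(i+1)].  If [a_(i+1)] is an end of another chord, the two chords
    become one.  If it is the other end of the same chord, the current path
    absorbs that chord by the detour [b_i, a_i, chord, a_(i+1), b_(i+1)].  No
    balance condition is needed: the leftmost pending ends are paired whatever
    chords they belong to ([sweep_ladder]).

    The ladder ([exists_ladder]) is built on a random set of hubs of density
    about [ln n / d], which is a dominating set; ordering it cyclically with
    bounded jumps uses that the cube of a connected graph is Hamiltonian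
    ([cube_order]).  Consecutive hubs are joined by random routes through a
    random middle vertex.  At some radius of order [ln n] balls around nearby
    vertices share at least half of their elements ([slow_growth]), so a uniform
    middle vertex suits both ends.  Vertex-transitivity makes the expected load
    of the routes the same at all vertices ([load_hit_ball]), and a random first
    step lets a single route use a given vertex with probability at most
    [O(ln n / d)] ([hit_nbr_le]).  These bounds make the routes meet so rarely
    that a disjoint choice exists ([exists_disjoint_routes]), by a local lemma for
    independent choices ([exists_conflict_free]).  The ladder has
    [O(n ln^2 n / d)] vertices, a negligible number.

    The chords come from a random partition of the vertices into a constant
    number of layers and a reservoir: almost perfect matchings between
    consecutive layers, by Hall's theorem, give a linear forest with few paths
    ([exists_linear_forest]).  Paths whose ends have a common free neighbour in
    the reservoir are then joined greedily ([greedy_merge]).  When this stops, a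
    free vertex sees the ends of at most one path, so different ends own disjoint
    large sets of free vertices; as every vertex sees many hubs, Hall's theorem
    hooks all ends to distinct feet ([exists_chords]). *)

(** * Hall's theorem *)

Section Hall.
Local Open Scope nat_scope.
Variables (L R : finType).

(** Induction on [A].  A proper subset with exactly as many neighbours as elements
    is matched first, and its neighbours are removed; if there is none, any edge
    can be used and its right end removed. *)
Lemma hall (r0 : R) (N : L -> {set R}) (A : {set L}) :
  (forall S : {set L}, S \subset A -> #|S| <= #|\bigcup_(x in S) N x|) ->
  exists f : L -> R, {in A &, injective f} /\ {in A, forall x, f x \in N x}.
Proof.
move: {2}#|A| (leqnn #|A|) => n; elim: n A N => [|n IHn] A N.
  rewrite leqn0 cards_eq0 => /eqP -> _.
  by exists (fun=> r0); split=> x; rewrite inE.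
move=> leAn hallA.
have [[S /and4P[S0 SA nSA crit]]|ncrit] :=
  pselect (exists S : {set L}, [&& S != set0, S \subset A, S != A &
     #|\bigcup_(x in S) N x| <= #|S|]).
- have ltSA : #|S| < #|A| by apply: proper_card; rewrite properEneq nSA.
  have [f1 [inj1 f1N]] : exists f : L -> R,
      {in S &, injective f} /\ {in S, forall x, f x \in N x}.
    apply: IHn; first by rewrite -ltnS (leq_trans ltSA).
    by move=> S' sS'; apply: hallA; apply: subset_trans SA.
  have [f2 [inj2 f2N]] : exists f : L -> R, {in A :\: S &, injective f} /\
      {in A :\: S, forall x, f x \in N x :\: \bigcup_(x in S) N x}.
    apply: IHn.
      rewrite -ltnS; apply: leq_trans leAn; rewrite cardsD (setIidPr SA).
      by rewrite ltn_subrL !card_gt0 S0 (contraTN _ ltSA) // => /eqP ->; rewrite cards0.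
    move=> S' sS'.
    have dSS' : [disjoint S & S'].
      rewrite disjoint_sym; apply/pred0P => x /=; apply/negbTE/negP => /andP[xS' xS].
      by move/subsetP: sS' => /(_ x xS'); rewrite inE xS.
    have /hallA : S :|: S' \subset A.
      by rewrite subUset SA (subset_trans sS') // subsetDl.
    rewrite cardsU (disjoint_setI0 dSS') cards0 subn0.
    have sub : \bigcup_(x in S :|: S') N x \subset
        (\bigcup_(x in S) N x) :|: \bigcup_(x in S') (N x :\: \bigcup_(x in S) N x).
      apply/subsetP => y /bigcupP[x]; rewrite !inE => /orP[xS|xS'] yNx.
        by apply/orP; left; apply/bigcupP; exists x.
      case: (boolP (y \in \bigcup_(x in S) N x)) => //= yS.
      by apply/bigcupP; exists x => //; rewrite inE yS.
    move=> h; have := leq_trans h (subset_leq_card sub).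
    rewrite cardsU => h2; have := leq_trans h2 (leq_subr _ _); lia.
  exists (fun x => if x \in S then f1 x else f2 x); split=> [x y xA yA|x xA].
    case: ifPn => xS; case: ifPn => yS; first exact: inj1.
    - have := f2N y; rewrite !inE yS yA => /(_ isT)/andP[+ _] fxy.
      by rewrite -fxy => /bigcupP[]; exists x => //; apply: f1N.
    - have := f2N x; rewrite !inE xS xA => /(_ isT)/andP[+ _] fxy.
      by rewrite fxy => /bigcupP[]; exists y => //; apply: f1N.
    - by apply: inj2; rewrite inE ?xS ?yS.
  case: ifPn => xS; first exact: f1N.
  by have := f2N x; rewrite !inE xS xA => /(_ isT)/andP[].
- have [->|[x xA]] := set_0Vmem A.
    by exists (fun=> r0); split=> x; rewrite inE.
  have /card_gt0P[y yNx] : 0 < #|N x|.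
    have := hallA [set x]; rewrite sub1set xA cards1 => /(_ isT).
    by rewrite big_set1.
  have [f [injf fN]] : exists f : L -> R, {in A :\ x &, injective f} /\
      {in A :\ x, forall z, f z \in N z :\ y}.
    apply: IHn; first by have := cardsD1 x A; rewrite xA; lia.
    move=> S sS.
    have [->|S0] := eqVneq S set0; first by rewrite cards0.
    have ltS : #|S| < #|\bigcup_(z in S) N z|.
      rewrite ltnNge; apply/negP => crit; apply: ncrit; exists S.
      rewrite S0 crit (subset_trans sS (subsetDl _ _)) /= andbT.
      by apply: contraTneq sS => ->; apply/subsetPn; exists x; rewrite // !inE eqxx.
    have sub : (\bigcup_(z in S) N z) :\ y \subset \bigcup_(z in S) (N z :\ y).
      apply/subsetP => w; rewrite inE => /andP[wy /bigcupP[z zS wz]].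
      by apply/bigcupP; exists z => //; rewrite inE wy.
    have := subset_leq_card sub; have := cardsD1 y (\bigcup_(z in S) N z).
    by case: (_ \in _) => /=; lia.
  exists (fun z => if z == x then y else f z); split=> [u v uA vA|z zA].
    case: eqP => [->|/eqP ux]; case: eqP => [->//|/eqP vx].
    - move=> yf; have := fN v; rewrite !inE vx vA => /(_ isT).
      by rewrite -yf eqxx.
    - move=> fy; have := fN u; rewrite !inE ux uA => /(_ isT).
      by rewrite fy eqxx.
    - by apply: injf; rewrite !inE ?ux ?vx.
  case: eqP => [->//|/eqP zx].
  by have := fN z; rewrite !inE zx zA => /(_ isT)/andP[].
Qed.

End Hall.

Section HallCor.
Local Open Scope nat_scope.
Variables (L R : finType).

(** [k] dummy right vertices adjacent to everything absorb the deficiency. *)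
Lemma hall_deficient (r0 : R) (N : L -> {set R}) (A : {set L}) (k : nat) :
  (forall S : {set L}, S \subset A -> #|S| <= #|\bigcup_(x in S) N x| + k) ->
  exists (B : {set L}) (f : L -> R),
    [/\ B \subset A, #|A| <= #|B| + k, {in B &, injective f}
      & {in B, forall x, f x \in N x}].
Proof.
move=> hallA.
pose N' x : {set R + 'I_k} := (inl @: N x) :|: (inr @: [set: 'I_k]).
have [|f [injf fN]] := @hall L (R + 'I_k)%type (inl r0) N' A.
  move=> S sSA; have [->|[x xS]] := set_0Vmem S; first by rewrite cards0.
  have sub : (inl @: \bigcup_(x in S) N x) :|: (inr @: [set: 'I_k])
       \subset \bigcup_(x in S) N' x.
    apply/subsetP => z /setUP[/imsetP[y /bigcupP[w wS yw] ->]|zr].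
      by apply/bigcupP; exists w => //; rewrite inE imset_f.
    by apply/bigcupP; exists x => //; rewrite inE zr orbT.
  have := subset_leq_card sub.
  rewrite cardsU (_ : _ :&: _ = set0) ?cards0 ?subn0; last first.
    apply/setP => z; rewrite in_setI in_set0; apply/negbTE/negP.
    by case/andP => /imsetP[y _ ->] /imsetP[w _ E]; discriminate E.
  have inlI : injective (@inl R 'I_k) by move=> u v [].
  have inrI : injective (@inr R 'I_k) by move=> u v [].
  rewrite (card_imset _ inlI) (card_imset _ inrI) cardsT card_ord => le2.
  by apply: leq_trans (hallA _ sSA) le2.
pose f' x := if f x is inl y then y else r0.
pose B := [set x in A | if f x is inl _ then true else false].
have BA : B \subset A by apply/subsetP => x; rewrite inE => /andP[].
exists B, f'; split=> //.
- have sub : f @: (A :\: B) \subset inr @: [set: 'I_k].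
    apply/subsetP => z /imsetP[x]; rewrite !inE => /andP[+ xA] ->.
    by rewrite xA /=; case: (f x) => // i _; rewrite imset_f.
  have := subset_leq_card sub.
  have inrI : injective (@inr R 'I_k) by move=> u v [].
  rewrite (card_imset _ inrI) cardsT card_ord card_in_imset.
    by rewrite cardsD (setIidPr BA); have := subset_leq_card BA; lia.
  by move=> x y /setDP[xA _] /setDP[yA _]; apply: injf.
- move=> x y; rewrite !inE => /andP[xA fx] /andP[yA fy] ff.
  apply: injf => //; move: ff fx fy; rewrite /f'.
  by case: (f x) => // u; case: (f y) => // v ->.
- move=> x; rewrite inE => /andP[xA]; have := fN x xA; rewrite /f' /N'.
  case: (f x) => // y; rewrite inE => /orP[/imsetP[z zN [->]]//|].
  by move=> /imsetP[].
Qed.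

(** Double counting of the pairs [(x, y)] with [y \in N x]. *)
Lemma ler_card_neighbours (K : numDomainType) (N : L -> {set R}) (S : {set L}) (a b : K) :
  {in S, forall x, (a <= #|N x|%:R)%R} ->
  (forall y, (#|[set x in S | y \in N x]|%:R <= b)%R) ->
  (#|S|%:R * a <= #|\bigcup_(x in S) N x|%:R * b)%R.
Proof.
move=> ha hb; set U := \bigcup_(x in S) N x.
apply: (@le_trans _ _ (\sum_(x in S) #|N x|%:R)%R).
  by rewrite mulr_natl -sumr_const; apply: ler_sum => x /ha.
rewrite [leRHS]mulr_natl -sumr_const.
have -> : (\sum_(x in S) #|N x|%:R = \sum_(x in S) \sum_(y in U) ((y \in N x)%:R : K))%R.
  apply: eq_bigr => x xS; rewrite -natr_sum -big_mkcondr sum1dep_card; congr (_%:R)%R.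
  apply: eq_card => y; rewrite !inE; apply/esym/andb_idl => yN.
  by apply/bigcupP; exists x.
rewrite exchange_big; apply: ler_sum => y _ /=.
by apply: le_trans (hb y); rewrite -natr_sum -big_mkcondr sum1dep_card.
Qed.

End HallCor.

(** * Random colourings *)

Section Colouring.
Variables (R : realType) (T I : finType) (Q : nat).

(** A union bound with exponential moments.  If every colouring violated one of the
    conditions, the sum over [i] of [expR (X i - tau i)], where [X i] is the
    weight of the vertices with colour in [J i], would always be at least [1].
    Its average over all colourings factorises over the vertices and is at most
    the sum assumed to be less than [1]. *)
Lemma exists_colouring (J : I -> {set 'I_Q.+1}) (w : I -> T -> R) (tau : I -> R) :
  \sum_i expR (\sum_u #|J i|%:R / Q.+1%:R * (expR (w i u) - 1) - tau i) < 1 ->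
  exists c : T -> 'I_Q.+1, forall i, \sum_(u | c u \in J i) w i u <= tau i.
Proof.
move=> lt1.
have [//|nex] := pselect (exists c : T -> 'I_Q.+1,
  forall i, \sum_(u | c u \in J i) w i u <= tau i).
exfalso; move: lt1; apply/negP; rewrite -leNgt.
pose q : R := Q.+1%:R.
have q0 : 0 < q by rewrite ltr0n.
pose X (c : {ffun T -> 'I_Q.+1}) i := \sum_(u | c u \in J i) w i u.
have ge1 (c : {ffun T -> 'I_Q.+1}) : 1 <= \sum_i expR (X c i - tau i).
  have [i lt_i] : exists i, tau i < X c i.
    apply: contrapT => H; apply: nex; exists c => i.
    by rewrite leNgt; apply/negP => lt_i; apply: H; exists i.
  rewrite (bigD1 i) //=; apply: (@le_trans _ _ (expR (X c i - tau i))).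
    by rewrite -expR0 ler_expR; lra.
  by rewrite lerDl sumr_ge0 // => j _; apply: expR_ge0.
have avg i : \sum_(c : {ffun T -> 'I_Q.+1}) expR (X c i - tau i) <=
    q ^+ #|T| * expR (\sum_u #|J i|%:R / q * (expR (w i u) - 1) - tau i).
  under eq_bigr => c _.
    rewrite expRD /X big_mkcond /= expR_sum; over.
  rewrite -mulr_suml -(bigA_distr_bigA (fun u (a : 'I_Q.+1) =>
      expR (if a \in J i then w i u else 0))) /=.
  rewrite expRD mulrA ler_wpM2r ?expR_ge0 //.
  rewrite expR_sum -(prodr_const (mem T) q) -big_split /=.
  apply: ler_prod => u _; apply/andP; split.
    by apply: sumr_ge0 => a _; apply: expR_ge0.
  have -> : \sum_(a < Q.+1) expR (if a \in J i then w i u else 0) =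
      q * (1 + #|J i|%:R / q * (expR (w i u) - 1)).
    rewrite mulrDr mulr1 mulrA mulrCA mulfV ?gt_eqF // mulr1.
    rewrite (eq_bigr (fun a : 'I_Q.+1 =>
       1 + (if a \in J i then expR (w i u) - 1 else 0))); last first.
      by move=> a _; case: ifP; rewrite ?expR0; lra.
    rewrite big_split /= sumr_const card_ord -big_mkcond /= sumr_const.
    by rewrite mulr_natl.
  by rewrite ler_pM2l // expR_ge1Dx.
have : q ^+ #|T| <= q ^+ #|T| *
    \sum_i expR (\sum_u #|J i|%:R / q * (expR (w i u) - 1) - tau i).
  rewrite mulr_sumr; apply: le_trans (ler_sum _ (fun i _ => avg i)).
  rewrite exchange_big /=.
  apply: le_trans (ler_sum _ (fun c _ => ge1 c)).
  by rewrite sumr_const card_ffun card_ord -natrX.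
by rewrite ler_pMr ?exprn_gt0.
Qed.

End Colouring.

(** * A local lemma for independent choices *)

Section IndependentChoices.
Variables (R : realType) (I O : finType) (mu : I -> O -> R) (conf : rel O).
Hypothesis mu_ge0 : forall i o, 0 <= mu i o.
Hypothesis mu_sum1 : forall i, \sum_o mu i o = 1.
Hypothesis conf_sym : symmetric conf.

Let upd (f : {ffun I -> O}) (i : I) (o : O) : {ffun I -> O} :=
  [ffun j => if j == i then o else f j].
Let pr (f : {ffun I -> O}) : R := \prod_i mu i (f i).

Let prob (g : {ffun I -> O} -> R) : R := \sum_f pr f * g f.

Let pr_ge0 f : 0 <= pr f.
Proof. by apply: prodr_ge0 => i _. Qed.

(** Exchanging the old and the new value of the coordinate preserves the product of
    their weights. *)
Let resample (i : I) (g : {ffun I -> O} -> R) :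
  prob g = prob (fun f => \sum_o mu i o * g (upd f i o)).
Proof.
pose h (x : {ffun I -> O} * O) := (upd x.1 i x.2, x.1 i).
have hK : involutive h.
  case=> f o; rewrite /h /=; congr (_, _); last by rewrite ffunE eqxx.
  by apply/ffunP => j; rewrite !ffunE; case: eqP => // ->.
rewrite /prob.
under [RHS]eq_bigr do rewrite mulr_sumr.
rewrite pair_bigA /= (reindex_inj (inv_inj hK)) /=.
transitivity (\sum_f \sum_o pr f * mu i o * g f).
  by apply: eq_bigr => f _; rewrite -mulr_suml -mulr_sumr mu_sum1 mulr1.
rewrite pair_bigA /=; apply: eq_bigr => -[f o] _ /=.
have -> : upd (upd f i o) i (f i) = f by apply: (congr1 fst (hK (f, o))).
rewrite mulrA; congr (_ * _); rewrite /pr (bigD1 i) //= [in RHS](bigD1 i) //=.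
rewrite ffunE eqxx mulrAC [RHS]mulrAC; congr (_ * _); first by rewrite mulrC.
by apply: eq_bigr => j ji; rewrite ffunE (negPf ji).
Qed.

Let good (X : {set I}) (f : {ffun I -> O}) : bool :=
  [forall i in X, forall j in X, (i != j) ==> ~~ conf (f i) (f j)].
Let Z (X : {set I}) : R := prob (fun f => (good X f)%:R).

Let goodP (X : {set I}) (f : {ffun I -> O}) : reflect
  (forall i j, i \in X -> j \in X -> i != j -> ~~ conf (f i) (f j)) (good X f).
Proof.
apply: (iffP forall_inP) => [H i j iX jX ij|H i iX].
  by have /forall_inP/(_ j jX) := H i iX; rewrite ij.
by apply/forall_inP => j jX; apply/implyP; apply: H.
Qed.

Let good_upd (X : {set I}) (f : {ffun I -> O}) i o : i \notin X -> good X (upd f i o) = good X f.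
Proof.
move=> iX; apply/goodP/goodP => H j k jX kX jk; have := H j k jX kX jk;
  by rewrite !ffunE; do 2 (case: eqP => [E|_]; first by rewrite -E ?jX ?kX in iX).
Qed.

Hypothesis conf_small : forall i,
  \sum_(j | j != i) \sum_o \sum_(o' | conf o o') mu i o * mu j o' <= 4^-1.

Let prob_conf (X : {set I}) i j : i \notin X -> j \notin X -> i != j ->
  prob (fun f => (good X f && conf (f i) (f j))%:R) =
  Z X * \sum_o \sum_(o' | conf o o') mu i o * mu j o'.
Proof.
move=> iX jX ij; rewrite (resample i).
under [LHS]eq_bigr do under eq_bigr do rewrite good_upd // !ffunE eqxx eq_sym (negPf ij).
rewrite -/(prob (fun f => \sum_o mu i o * (good X f && conf o (f j))%:R)).
rewrite (resample j) /Z /prob mulr_suml; apply: eq_bigr => f _.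
rewrite -mulrA; congr (_ * _).
under eq_bigr do rewrite mulr_sumr.
rewrite exchange_big /= mulr_sumr; apply: eq_bigr => o _.
rewrite mulr_sumr [RHS]big_mkcond /=; apply: eq_bigr => o' _.
rewrite good_upd // ffunE eqxx.
by case: (good X f); case: (conf o o'); rewrite /= ?(mulr0, mulr1, mul0r, mul1r) // mulrC.
Qed.

Let goodS (X Y : {set I}) (f : {ffun I -> O}) : X \subset Y -> good Y f -> good X f.
Proof.
move=> /subsetP sXY /goodP H; apply/goodP => i j /sXY iX /sXY jX.
exact: H.
Qed.

(** Let [Z X] be the probability that no two coordinates in [X] conflict.  A new
    coordinate [i] conflicts with [j \in X] independently of the coordinates in
    [X :\ j], and by induction [Z (X :\ j)] is at most twice [Z X]; so at most
    half of [Z X] is lost. *)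
Let Z_halving n : forall (X : {set I}) i, (#|X| <= n)%N -> i \notin X -> Z X <= 2 * Z (i |: X).
Proof.
elim: n => [|n IHn] X i leX iX.
  move: leX; rewrite leqn0 cards_eq0 => /eqP ->.
  have Z1 (Y : {set I}) : (forall f, good Y f) -> Z Y = 1.
    move=> gY; rewrite /Z /prob (eq_bigr pr); last by move=> f _; rewrite gY mulr1.
    by rewrite -(bigA_distr_bigA mu) big1.
  rewrite !Z1; first by lra.
    move=> f; apply/goodP => j k; rewrite setU0 !inE => /eqP -> /eqP ->.
    by rewrite eqxx.
  by move=> f; apply/goodP => j k; rewrite inE.
pose c j := \sum_o \sum_(o' | conf o o') mu i o * mu j o'.
have ub : Z X - \sum_(j in X) Z (X :\ j) * c j <= Z (i |: X).
  have -> : \sum_(j in X) Z (X :\ j) * c j =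
     \sum_(j in X) prob (fun f => (good (X :\ j) f && conf (f i) (f j))%:R).
    apply: eq_bigr => j jX; rewrite prob_conf ?inE ?eqxx ?(negPf iX) ?andbF //.
    by apply: contraNneq iX => ->.
  rewrite /Z /prob exchange_big /= -sumrB; apply: ler_sum => f _.
  rewrite -mulr_sumr -mulrBr ler_wpM2l //.
  have [gX|gX] := boolP (good X f); last first.
    apply: (@le_trans _ _ 0); last by rewrite ler0n.
    by rewrite sub0r oppr_le0 sumr_ge0.
  have [|] := boolP (good (i |: X) f) => gi.
    by rewrite lerBlDr lerDl sumr_ge0.
  have [j jX cij] : exists2 j, j \in X & conf (f i) (f j).
    apply: contrapT => H; move/negP: gi; apply.
    apply/goodP => a b /setU1P[->|aX] /setU1P[->|bX].
    - by rewrite eqxx.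
    - by move=> _; apply/negP => ?; apply: H; exists b.
    - by rewrite conf_sym => _; apply/negP => ?; apply: H; exists a.
    - by move/goodP: gX; apply.
  rewrite (bigD1 j) //= cij (goodS _ gX) ?subsetDl //=.
  have : 0 <= \sum_(i0 in X | i0 != j) (good (X :\ i0) f && conf (f i) (f i0))%:R :> R.
    by apply: sumr_ge0.
  by lra.
have c_ge0 j : 0 <= c j.
  by apply: sumr_ge0 => o _; apply: sumr_ge0 => o' _; apply: mulr_ge0.
have Z_ge0 Y : 0 <= Z Y by apply: sumr_ge0 => f _; rewrite mulr_ge0.
have : \sum_(j in X) Z (X :\ j) * c j <= 2 * Z X * 4^-1.
  apply: (@le_trans _ _ (\sum_(j in X) 2 * Z X * c j)).
    apply: ler_sum => j jX; apply: ler_wpM2r => //.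
    rewrite -{2}(setD1K jX); apply: IHn; last by rewrite !inE eqxx.
    by have := cardsD1 j X; rewrite jX; lia.
  rewrite -mulr_sumr ler_wpM2l ?mulr_ge0 //.
  apply: le_trans (conf_small i); rewrite -/c.
  rewrite [leRHS](bigID (fun j => j \in X)) /=.
  rewrite [X in _ <= X + _](eq_bigl (fun j => j \in X)); last first.
    by move=> j /=; apply: andb_idl => jX; apply: contraNneq iX => <-.
  by rewrite lerDl sumr_ge0 // => j _; apply: c_ge0.
by lra.
Qed.

(** Rosenfeld's counting argument: adding the coordinates one by one keeps the
    probability of having no conflict positive. *)
Lemma exists_conflict_free : exists f : I -> O,
  (forall i, 0 < mu i (f i)) /\ (forall i j, i != j -> ~~ conf (f i) (f j)).
Proof.
have Zpos (X : {set I}) : 0 < Z X.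
  have [n] := ubnP #|X|; elim: n X => // n IHn X leX.
  have [->|[i iX]] := set_0Vmem X.
    rewrite /Z /prob (eq_bigr pr).
      by rewrite -(bigA_distr_bigA mu) big1.
    move=> f _; rewrite (_ : good _ f) ?mulr1 //.
    by apply/goodP => j k; rewrite inE.
  have lt1 : (#|X :\ i| < #|X|)%N by rewrite (cardsD1 i X) iX.
  have := @Z_halving _ (X :\ i) i (leqnn _).
  rewrite !inE eqxx setD1K // => /(_ isT).
  have := IHn (X :\ i) (leq_trans lt1 leX).
  by lra.
have [f fP] : exists f, 0 < pr f * (good [set: I] f)%:R.
  apply: contrapT => H; have := Zpos [set: I]; apply/negP; rewrite -leNgt.
  apply: sumr_le0 => f _; rewrite leNgt; apply/negP => fP.
  by apply: H; exists f.
exists f; split=> [i|i j ij].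
  rewrite lt_neqAle mu_ge0 andbT eq_sym; apply: contraTneq fP => mu0.
  by rewrite /pr (bigD1 i) //= mu0 !mul0r ltxx.
move: fP; case gT: (good _ f); last by rewrite mulr0 ltxx.
by move=> _; move/goodP: gT; apply.
Qed.

End IndependentChoices.

(** * The cube of a connected graph is Hamiltonian *)

Section CubeOrder.
Local Open Scope nat_scope.
Variables (T : finType) (h : rel T).
Hypotheses (h_refl : reflexive h) (h_sym : symmetric h).

Definition cube_rel : rel T :=
  [rel u v | [exists x, exists y, [&& h u x, h x y & h y v]]].

Definition induced (S : {set T}) : rel T :=
  [rel u v | [&& u \in S, v \in S & h u v]].

Lemma cube_relI u x y v : h u x -> h x y -> h y v -> cube_rel u v.
Proof. by move=> ux xy yv; apply/existsP; exists x; apply/existsP; exists y; rewrite ux xy. Qed.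

Lemma cube_rel_sym : symmetric cube_rel.
Proof.
suff imp u v : cube_rel u v -> cube_rel v u by move=> u v; apply/idP/idP; apply: imp.
move=> /existsP[x /existsP[y /and3P[ux xy yv]]].
by apply: (@cube_relI v y x u); rewrite h_sym.
Qed.

(** For a neighbour [y] of [x], the component [S'] of [y] in [S :\ x] and the rest
    [S''] are both connected.  An order of [S''] from [x] followed by the reverse
    of an order of [S'] from [y] jumps only once between the two, by at most
    three steps, and ends at [y]; this is why the last element is required to be
    close to the first. *)
Lemma cube_order (S : {set T}) x : x \in S ->
  (forall y, y \in S -> connect (induced S) x y) ->
  exists s, [/\ uniq (x :: s), x :: s =i S, path cube_rel x s & h x (last x s)].
Proof.
have [n] := ubnP #|S|; elim: n S x => // n IHn S x leS xS conS.
have [S1|[w]] := set_0Vmem (S :\ x).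
  exists [::]; split=> // z; rewrite !inE; apply/eqP/idP => [->//|zS].
  apply/eqP; apply: contraT => zx.
  by have := in_set0 z; rewrite -S1 !inE zx zS.
rewrite !inE => /andP[wx wS].
have [y [yS yx hxy]] : exists y, [/\ y \in S, y != x & h x y].
  case/connectP: (conS w wS) => p; elim: p => [|z p IHp] /=.
    by move=> _ wxE; rewrite wxE eqxx in wx.
  have [-> /andP[_]|zx] := eqVneq z x; first exact: IHp.
  by case/andP => /and3P[_ zS hxz] _ _; exists z.
pose S' := [set z in S :\ x | connect (induced (S :\ x)) y z].
pose S'' := S :\: S'.
have S'S : S' \subset S :\ x by apply/subsetP => z; rewrite inE => /andP[].
have yS' : y \in S' by rewrite !inE yx yS connect0.
have xS'' : x \in S'' by rewrite !inE eqxx.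
have conS' z : z \in S' -> connect (induced S') y z.
  rewrite inE => /andP[_ /connectP[p]].
  elim/last_ind: p z => [|p u IHp] z /=; first by move=> _ ->; rewrite connect0.
  rewrite rcons_path last_rcons => /andP[pth hu ->].
  have lS' : last y p \in S'.
    move: hu => /and3P[lS _ _]; rewrite inE lS.
    by apply/connectP; exists p.
  apply: connect_trans (IHp _ pth erefl) _; apply: connect1.
  case/and3P: hu => _ uS hlu; apply/and3P; split=> //; rewrite inE uS /=.
  apply/connectP; exists (rcons p u); rewrite ?last_rcons // rcons_path pth /=.
  by move: lS'; rewrite inE => /andP[l1 _]; apply/and3P.
have conS'' z : z \in S'' -> connect (induced S'') x z.
  move=> zS''; have zS : z \in S by move: zS''; rewrite inE => /andP[].
  case/connectP: (conS z zS) => p; elim/last_ind: p z zS'' {zS} => [|p u IHp] z zS''.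
    by move=> _ ->; rewrite connect0.
  rewrite rcons_path last_rcons => /andP[pth /and3P[lS uS hlu]] zu.
  have [->|zx] := eqVneq z x; first by rewrite connect0.
  have lS'' : last x p \in S''.
    rewrite inE lS andbT; apply/negP => lS'.
    move: zS''; rewrite inE => /andP[/negP[]]; rewrite zu !inE -{1}zu zx uS /=.
    move: lS'; rewrite inE => /andP[lS1 con].
    apply: connect_trans con _; apply: connect1; apply/and3P; split=> //.
    by rewrite !inE -{1}zu zx uS.
  apply: connect_trans (IHp _ lS'' pth erefl) _; apply: connect1.
  by apply/and3P; split; rewrite // zu.
have cS : #|S| = #|S'| + #|S''|.
  by rewrite -(cardsID S' S) setIC (setIidPl _) // (subset_trans S'S) // subsetDl.
have c' : 0 < #|S'| by rewrite (cardsD1 y) yS'.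
have c'' : 0 < #|S''| by rewrite (cardsD1 x) xS''.
have lt'' : #|S''| < n.
  by move: leS; rewrite cS ltnS; apply: leq_trans; rewrite -addn1 addnC leq_add2r.
have lt' : #|S'| < n.
  by move: leS; rewrite cS ltnS; apply: leq_trans; rewrite -addn1 leq_add2l.
have [|s1 [u1 m1 p1 l1]] := IHn S'' x _ xS'' conS''; first exact: lt''.
have [|s2 [u2 m2 p2 l2]] := IHn S' y _ yS' conS'; first exact: lt'.
exists (s1 ++ rev (y :: s2)); split.
- rewrite -cat_cons cat_uniq u1 rev_uniq u2 andbT /=.
  apply/hasPn => z; rewrite mem_rev m2 => zS'.
  by apply/negP => /=; rewrite m1 inE zS'.
- move=> z; rewrite -cat_cons mem_cat mem_rev m1 m2 inE.
  case zS': (z \in S') => /=; last by rewrite orbF.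
  by have := subsetP S'S z zS'; rewrite inE => /andP[_ ->].
- rewrite cat_path p1 /= lastI rev_rcons /= .
  apply/andP; split.
    by apply: (@cube_relI _ x y); rewrite // h_sym.
  by rewrite rev_path (eq_path (e' := cube_rel)) // => a b /=; rewrite cube_rel_sym.
- by rewrite last_cat rev_cons last_rcons.
Qed.

End CubeOrder.

(** * Balls, and the load of random connections *)

Section Balls.
Local Open Scope nat_scope.
Variables (T : finType) (e : rel T).

Fixpoint ball (x : T) (k : nat) : {set T} :=
  if k is k'.+1 then ball x k' :|: [set z | [exists u in ball x k', e u z]]
  else [set x].

Lemma ball_step x u z k : u \in ball x k -> e u z -> z \in ball x k.+1.
Proof.
move=> ux uz; rewrite /= in_setU [X in _ || X]inE; apply/orP; right.
by apply/existsP; exists u; rewrite ux.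
Qed.

Lemma ballSP x z k : reflect (z \in ball x k \/ exists2 u, u \in ball x k & e u z)
  (z \in ball x k.+1).
Proof.
rewrite /= in_setU [X in _ || X]inE.
apply: (iffP orP) => [[->|/existsP[u /andP[ux uz]]]|[->|[u ux uz]]].
- by left.
- by right; exists u.
- by left.
- by right; apply/existsP; exists u; rewrite ux.
Qed.

Lemma ball_trans x y z j k : y \in ball x j -> z \in ball y k -> z \in ball x (j + k).
Proof.
move=> yx; elim: k z => [|k IHk] z; first by rewrite inE => /eqP ->; rewrite addn0.
rewrite addnS => /ballSP[/IHk|[u /IHk]]; last exact: ball_step.
by move=> zx; apply/ballSP; left.
Qed.

Lemma ball_center x k : x \in ball x k.
Proof. by elim: k => [|k IHk]; [rewrite inE|apply/ballSP; left]. Qed.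

Lemma subset_ball x j k : j <= k -> ball x j \subset ball x k.
Proof.
move=> jk; apply/subsetP => z zx; rewrite -(subnKC jk).
by apply: ball_trans zx _; apply: ball_center.
Qed.

Lemma ball1 x z : e x z -> z \in ball x 1.
Proof. by apply: ball_step; apply: ball_center. Qed.

Lemma ball_sym : symmetric e -> forall x z k, z \in ball x k -> x \in ball z k.
Proof.
move=> e_sym x z k; elim: k z => [|k IHk] z; first by rewrite !inE eq_sym.
case/ballSP => [/IHk H|[u /IHk ux uz]]; first by apply/ballSP; left.
rewrite -add1n; apply: ball_trans ux; apply: ball1.
by rewrite e_sym.
Qed.

(** Otherwise the size of the ball would double more than [log2 #|T|] times. *)
Lemma slow_growth x t : exists2 j, j <= trunc_log 2 #|T| &
  #|ball x (t * j.+1)| <= 2 * #|ball x (t * j)|.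
Proof.
have n0 : 0 < #|T| by apply/card_gt0P; exists x.
have [[j ? ?]|nex] := pselect (exists2 j, j <= trunc_log 2 #|T| &
  #|ball x (t * j.+1)| <= 2 * #|ball x (t * j)|); first by exists j.
suff H j : j <= (trunc_log 2 #|T|).+1 -> 2 ^ j <= #|ball x (t * j)|.
  have /(leq_trans (H _ (leqnn _))) := max_card (mem (ball x (t * (trunc_log 2 #|T|).+1))).
  by rewrite leqNgt trunc_log_ltn.
elim: j => [_|j IHj lej]; first by rewrite muln0 /= cards1.
rewrite expnS; apply: leq_trans (leq_mul (leqnn 2) (IHj (ltnW lej))) _.
rewrite leqNgt; apply/negP => lt; apply: nex; exists j; last exact: ltnW.
by rewrite -ltnS.
Qed.

(** A connection is encoded by a vertex set that contains a path from [x] to [z]: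
    only disjointness matters for the routes, and such sets are visibly permuted
    by the automorphisms. *)
Definition joining (r : nat) (x z : T) : {set {set T}} :=
  [set S : {set T} | [&& #|S| <= r, x \in S & connect (induced e S) x z]].

Lemma joining_ball x z k : z \in ball x k -> exists S, S \in joining k.+1 x z.
Proof.
elim: k z => [|k IHk] z.
  rewrite inE => /eqP ->; exists [set x].
  by rewrite !inE cards1 eqxx connect0.
have widen (S S' : {set T}) u v : S \subset S' -> connect (induced e S) u v ->
    connect (induced e S') u v.
  move=> /subsetP SS'; apply: connect_sub => a b /and3P[aS bS ab].
  by apply: connect1; apply/and3P; split=> //; apply: SS'.
case/ballSP => [/IHk[S]|[u /IHk[S]]].
  by rewrite inE => /and3P[S1 S2 S3]; exists S; rewrite inE (leq_trans S1) // S2.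
rewrite inE => /and3P[S1 S2 S3] uz; exists (z |: S).
rewrite inE cardsU1 setU1r //=.
apply/andP; split; first by move: S1; case: (z \notin S) => /=; lia.
have sub : S \subset z |: S by apply: subsetUr.
apply: connect_trans (widen _ _ _ _ sub S3) _; apply: connect1.
apply/and3P; split=> //; [|exact: setU11].
apply: (subsetP sub); case/connectP: S3 => p; case/lastP: p => [_ ->//|p w].
by rewrite rcons_path last_rcons => /andP[_ /and3P[_ wS _]] ->.
Qed.

Section Automorphism.
Variable s : {perm T}.
Hypothesis s_aut : automorphism e s.

Lemma ball_aut x k : ball (s x) k = s @: ball x k.
Proof.
elim: k => [|k IHk] /=; first by rewrite imset_set1.
rewrite imsetU IHk; congr (_ :|: _); apply/setP => z; rewrite !inE.
apply/existsP/imsetP => [[u /andP[/imsetP[w wB ->] wz]]|[w]].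
  exists ((s^-1)%g z); last by rewrite permKV.
  rewrite inE; apply/existsP; exists w; rewrite wB /=.
  by rewrite -s_aut permKV.
rewrite inE => /existsP[u /andP[uB uw]] ->; exists (s u).
by rewrite imset_f // s_aut.
Qed.

Lemma connect_aut S x z : connect (induced e S) x z ->
  connect (induced e (s @: S)) (s x) (s z).
Proof.
case/connectP => p; elim/last_ind: p z => [|p w IHp] z; first by move=> _ ->; apply: connect0.
rewrite rcons_path last_rcons => /andP[pp /and3P[lS wS lw]] ->.
apply: connect_trans (IHp _ pp erefl) _; apply: connect1.
by apply/and3P; rewrite !imset_f // s_aut.
Qed.

End Automorphism.

Lemma automorphismV (s : {perm T}) : automorphism e s -> automorphism e (s^-1)%g.
Proof. by move=> sA x y; rewrite -[in RHS](permKV s x) -[in RHS](permKV s y) sA. Qed.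

Lemma joining_aut (s : {perm T}) r x z : automorphism e s ->
  joining r (s x) (s z) = (fun S : {set T} => s @: S) @: joining r x z.
Proof.
move=> sA; apply/setP => S; apply/idP/imsetP => [|[S' + ->]].
  rewrite inE => /and3P[S1 S2 S3]; exists ((s^-1)%g @: S).
    rewrite inE (leq_trans (leq_imset_card _ _) S1) -{1}(permK s x) imset_f //=.
    by have := connect_aut (automorphismV sA) S3; rewrite !permK.
  rewrite -imset_comp (eq_imset (g := id)) ?imset_id // => u /=.
  by rewrite permKV.
rewrite !inE => /and3P[S1 S2 S3].
by rewrite (leq_trans (leq_imset_card _ _) S1) imset_f // connect_aut.
Qed.

Lemma card_ball_const k x y : vertex_transitive e -> #|ball x k| = #|ball y k|.
Proof.
move=> /(_ x y)[s [sA <-]]; rewrite ball_aut // card_imset //; exact: perm_inj.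
Qed.

End Balls.

Arguments ball : simpl never.

Section Spread.
Variables (R : realType) (T : finType) (e : rel T) (d : nat) (k : nat).
Hypotheses (e_sym : symmetric e) (e_reg : regular_graph e d).
Hypotheses (e_trans : vertex_transitive e) (d_gt0 : (0 < d)%N).

Let r := k.+1.

(** Probabilities that a random connection uses [v]: [hit] for a uniform connecting
    set between [x] and [z], [hit_ball] when [z] is moreover uniform in the ball
    around [x], and [hit_nbr] when the connection starts at a uniform neighbour of
    [x]. *)
Definition hit (x z v : T) : R :=
  #|[set S in joining e r x z | v \in S]|%:R / #|joining e r x z|%:R.
Definition hit_ball (x v : T) : R :=
  (\sum_(z in ball e x k) hit x z v) / #|ball e x k|%:R.
Definition hit_nbr (x v : T) : R := (\sum_(y | e x y) hit_ball y v) / d%:R.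

Lemma hit_ge0 x z v : 0 <= hit x z v.
Proof. by rewrite divr_ge0. Qed.

Lemma hit_ball_ge0 x v : 0 <= hit_ball x v.
Proof. by rewrite divr_ge0 // sumr_ge0 // => z _; apply: hit_ge0. Qed.

Lemma hit_nbr_ge0 x v : 0 <= hit_nbr x v.
Proof. by rewrite divr_ge0 // sumr_ge0 // => z _; apply: hit_ball_ge0. Qed.

Lemma sum_hit x z : \sum_v hit x z v <= r%:R.
Proof.
rewrite -mulr_suml -natr_sum.
have -> : (\sum_v #|[set S in joining e r x z | v \in S]|)%N =
    (\sum_(S in joining e r x z) #|S|)%N.
  transitivity (\sum_v \sum_(S in joining e r x z) (v \in S : nat))%N.
    apply: eq_bigr => v _; rewrite -big_mkcondr sum1dep_card.
    by apply: eq_card => S; rewrite !inE.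
  rewrite exchange_big; apply: eq_bigr => S _ /=.
  by rewrite -big_mkcond sum1_card.
have le : (\sum_(S in joining e r x z) #|S| <= r * #|joining e r x z|)%N.
  rewrite mulnC -sum_nat_const; apply: leq_sum => S.
  by rewrite inE => /and3P[].
have [->|J0] := eqVneq #|joining e r x z| 0%N; first by rewrite invr0 mulr0.
by rewrite ler_pdivrMr ?ltr0n ?lt0n // -natrM ler_nat.
Qed.

Let ball_gt0 x : (0 < #|ball e x k|)%N.
Proof. by apply/card_gt0P; exists x; apply: ball_center. Qed.

Lemma sum_hit_ball x : \sum_v hit_ball x v <= r%:R.
Proof.
rewrite -mulr_suml exchange_big /= ler_pdivrMr ?ltr0n //.
apply: le_trans (ler_sum _ (fun z _ => sum_hit x z)) _.
by rewrite sumr_const mulr_natr.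
Qed.

Let deg x : \sum_(y | e x y) (1 : R) = d%:R.
Proof.
rewrite sumr_const; congr (_ %:R); rewrite -(e_reg x).
by apply: eq_card => y; rewrite inE.
Qed.

Lemma sum_hit_nbr x : \sum_v hit_nbr x v <= r%:R.
Proof.
rewrite -mulr_suml exchange_big /= ler_pdivrMr ?ltr0n //.
apply: le_trans (ler_sum _ (fun z _ => sum_hit_ball z)) _.
by rewrite -(deg x) mulr_sumr; under [leRHS]eq_bigr do rewrite mulr1.
Qed.

Lemma hit_aut s x z v : automorphism e s -> hit (s x) (s z) (s v) = hit x z v.
Proof.
move=> sA; rewrite /hit joining_aut //.
have sI : injective (fun S : {set T} => s @: S) by apply/imset_inj/perm_inj.
rewrite (card_imset _ sI); congr (_ %:R / _).
rewrite -[RHS](card_imset _ sI); apply: eq_card => S.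
rewrite inE; apply/andP/imsetP => [[/imsetP[S' S'J ->]]|[S' + ->]].
  rewrite (mem_imset _ _ (@perm_inj _ s)) => vS'.
  by exists S' => //; rewrite inE S'J.
rewrite inE => /andP[S'J vS'].
by rewrite (mem_imset _ _ (@perm_inj _ s)) (mem_imset _ _ sI).
Qed.

Lemma hit_ball_aut s x v : automorphism e s -> hit_ball (s x) (s v) = hit_ball x v.
Proof.
move=> sA; rewrite /hit_ball ball_aut // card_imset; last exact: perm_inj.
congr (_ / _); rewrite big_imset /=; last by move=> ? ? _ _; apply: perm_inj.
by apply: eq_bigr => z _; apply: hit_aut.
Qed.

(** By transitivity the total load is the same at all vertices, hence average. *)
Lemma load_hit_ball v : \sum_x hit_ball x v <= r%:R.
Proof.
have load_const u : \sum_x hit_ball x u = \sum_x hit_ball x v.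
  have [s [sA <-]] := e_trans u v.
  rewrite [RHS](reindex_inj (@perm_inj _ s)) /=.
  by apply: eq_bigr => x _; rewrite hit_ball_aut.
have n0 : (0 < #|T|)%N by apply/card_gt0P; exists v.
rewrite -(ler_pM2l (_ : 0 < #|T|%:R :> R)) ?ltr0n // !mulr_natl -!sumr_const.
rewrite -(eq_bigr _ (fun u _ => load_const u)) exchange_big /=.
by apply: ler_sum => x _; apply: sum_hit_ball.
Qed.

Lemma load_hit_nbr v : \sum_x hit_nbr x v <= r%:R.
Proof.
apply: le_trans (load_hit_ball v); rewrite -mulr_suml.
rewrite (exchange_big_dep predT) //= ler_pdivrMr ?ltr0n // mulr_suml.
apply: ler_sum => y _; rewrite -(deg y) mulr_sumr.
under [leRHS]eq_bigr do rewrite mulr1.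
by rewrite (eq_bigl (e y)) // => x; rewrite e_sym.
Qed.

(** The random first step spreads the connection: the probability of using [v] is an
    average over [d] starting points, whose total is bounded by the load of [v]. *)
Lemma hit_nbr_le x v : hit_nbr x v <= r%:R / d%:R.
Proof.
rewrite ler_wpM2r ?invr_ge0 //; apply: le_trans (load_hit_ball v).
rewrite [leRHS](bigID (e x)) /= lerDl sumr_ge0 // => y _; exact: hit_ball_ge0.
Qed.

End Spread.

(** * Disjoint random routes *)

Section Routes.
Variables (R : realType) (T : finType) (e : rel T) (d : nat) (k : nat).
Hypotheses (e_sym : symmetric e) (e_reg : regular_graph e d) (d_gt0 : (0 < d)%N).

Let r := k.+1.
Let B x := ball e x k.
Let J x z := joining e r x z.

(** [((((x', y'), z), S), S')] stands for the route from [x] to a neighbour [x'], on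
    to [z] inside [S], then inside [S'] to a neighbour [y'] of [y]. *)
Definition route : Type := (((T * T) * T) * {set T}) * {set T}.
Definition route_verts (o : route) : {set T} := o.1.2 :|: o.2.

Let sum_route (G : T -> T -> T -> {set T} -> {set T} -> R) :
  \sum_(o : route) G o.1.1.1.1 o.1.1.1.2 o.1.1.2 o.1.2 o.2 =
  \sum_x \sum_y \sum_z \sum_S \sum_S' G x y z S S'.
Proof. by rewrite !pair_bigA. Qed.

Let aw x x' : R := (e x x')%:R / d%:R.
Let cw x y z : R := (z \in B x :&: B y)%:R / #|B x :&: B y|%:R.
Let jw x z S : R := (S \in J x z)%:R / #|J x z|%:R.

(** The distribution of the random route: [x'] and [y'] are uniform neighbours, [z] is
    uniform in the intersection of their balls, [S] and [S'] are uniform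
    connecting sets. *)
Definition route_weight (x y : T) (o : route) : R :=
  aw x o.1.1.1.1 * aw y o.1.1.1.2 * cw o.1.1.1.1 o.1.1.1.2 o.1.1.2 *
  jw o.1.1.1.1 o.1.1.2 o.1.2 * jw o.1.1.1.2 o.1.1.2 o.2.

Lemma route_weight_ge0 x y o : 0 <= route_weight x y o.
Proof. by rewrite /route_weight !mulr_ge0 // ?divr_ge0 ?ler0n ?invr_ge0. Qed.

Let sum_ind (X : finType) (A : {set X}) : \sum_a ((a \in A)%:R : R) = #|A|%:R.
Proof. by rewrite -natr_sum -big_mkcond sum1_card. Qed.

Let sum_aw x : \sum_x' aw x x' = 1.
Proof.
rewrite -mulr_suml -(e_reg x) -sum_ind.
under eq_bigr do rewrite -[e _ _]/(_ \in e x).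
have -> : \sum_i (i \in e x)%:R = \sum_a ((a \in [set y | e x y])%:R : R).
  by apply: eq_bigr => i _; rewrite inE.
by rewrite mulfV // sum_ind e_reg pnatr_eq0 -lt0n.
Qed.

Let sum_jw x z : z \in B x -> \sum_S jw x z S = 1.
Proof.
move=> zB; rewrite -mulr_suml sum_ind mulfV // pnatr_eq0 -lt0n.
by have [S SJ] := joining_ball zB; apply/card_gt0P; exists S.
Qed.

Let sum_jw_hit x z v : \sum_S jw x z S * (v \in S)%:R = hit R e k x z v.
Proof.
rewrite /hit -sum_ind mulr_suml; apply: eq_bigr => S _.
by rewrite /jw mulrAC inE -natrM mulnb.
Qed.

Section Pair.
Variables x y : T.
Hypothesis overlap : forall x' y', e x x' -> e y y' ->
  (#|B x'| <= 2 * #|B x' :&: B y'|)%N.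

Let aw0 x' y' (X Y : R) : (e x x' -> e y y' -> X <= Y) ->
  aw x x' * aw y y' * X <= aw x x' * aw y y' * Y.
Proof.
rewrite /aw; case: (e x x'); last by rewrite !mul0r.
case: (e y y'); last by rewrite mul0r mulr0 !mul0r.
by move=> /(_ isT isT) XY; rewrite ler_wpM2l // !mulr_ge0 ?invr_ge0.
Qed.

Let aw_eq x' y' (X Y : R) : (e x x' -> e y y' -> X = Y) ->
  aw x x' * aw y y' * X = aw x x' * aw y y' * Y.
Proof. by move=> XY; apply/le_anti; rewrite !aw0 // => *; rewrite XY. Qed.

Let meet_gt0 x' y' : e x x' -> e y y' -> (0 < #|B x' :&: B y'|)%N.
Proof.
move=> xx' yy'; have := overlap xx' yy'.
have : (0 < #|B x'|)%N by apply/card_gt0P; exists x'; apply: ball_center.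
lia.
Qed.

(* Summing out the second half of the route. *)
Let sum_second (g : T -> T -> T -> {set T} -> R) :
  \sum_o route_weight x y o * g o.1.1.1.1 o.1.1.1.2 o.1.1.2 o.1.2 =
  \sum_x' \sum_y' aw x x' * aw y y' *
     \sum_z cw x' y' z * \sum_S jw x' z S * g x' y' z S.
Proof.
rewrite (sum_route (fun x' y' z S S' => aw x x' * aw y y' * cw x' y' z *
  jw x' z S * jw y' z S' * g x' y' z S)).
apply: eq_bigr => x' _; apply: eq_bigr => y' _; rewrite mulr_sumr.
apply: eq_bigr => z _; rewrite !mulr_sumr; apply: eq_bigr => S _.
rewrite -mulr_suml -mulr_sumr.
have [zB|zB] := boolP (z \in B x' :&: B y').
  by move: zB; rewrite inE => /andP[_ zB]; rewrite sum_jw // mulr1 !mulrA.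
by rewrite /cw (negPf zB) !(mul0r, mulr0).
Qed.

Lemma sum_route_weight : \sum_o route_weight x y o = 1.
Proof.
transitivity (\sum_o route_weight x y o * 1).
  by apply: eq_bigr => o _; rewrite mulr1.
rewrite (sum_second (fun _ _ _ _ => 1)).
transitivity (\sum_x' \sum_y' aw x x' * aw y y').
  apply: eq_bigr => x' _; apply: eq_bigr => y' _.
  rewrite -[RHS]mulr1; apply: aw_eq => xx' yy'.
  transitivity (\sum_z cw x' y' z).
    apply: eq_bigr => z _; under eq_bigr do rewrite mulr1.
    have [zB|zB] := boolP (z \in B x' :&: B y').
      by move: zB; rewrite inE => /andP[zB _]; rewrite sum_jw // mulr1.
    by rewrite /cw (negPf zB) !mul0r.
  by rewrite -mulr_suml sum_ind mulfV // pnatr_eq0 -lt0n meet_gt0.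
by under eq_bigr do rewrite -mulr_sumr sum_aw mulr1; rewrite sum_aw.
Qed.

(** The factor [2] pays for choosing [z] in the intersection, at least half of the
    ball around [x'], instead of the whole ball. *)
Lemma route_hit_first v :
  \sum_o route_weight x y o * (v \in o.1.2)%:R <= 2 * hit_nbr R e d k x v.
Proof.
rewrite (sum_second (fun _ _ _ S => (v \in S)%:R)).
apply: (@le_trans _ _ (\sum_x' \sum_y' aw x x' * aw y y' * (2 * hit_ball R e k x' v))).
  apply: ler_sum => x' _; apply: ler_sum => y' _; apply: aw0 => xx' yy'.
  under eq_bigr do rewrite sum_jw_hit.
  have M0 := meet_gt0 xx' yy'.
  have Bx0 : (0 < #|B x'|)%N by apply/card_gt0P; exists x'; apply: ball_center.
  apply: (@le_trans _ _ (\sum_(z in B x') hit R e k x' z v / #|B x' :&: B y'|%:R)).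
    rewrite [leRHS]big_mkcond; apply: ler_sum => z _.
    rewrite /cw in_setI; case: (z \in B x') => /=; last by rewrite !mul0r.
    rewrite mulrC mulrA ler_wpM2r ?invr_ge0 //.
    by rewrite ler_piMr ?hit_ge0 //; case: (_ \in _).
  rewrite -mulr_suml /hit_ball mulrCA ler_wpM2l ?sumr_ge0 //.
    by move=> z _; apply: hit_ge0.
  rewrite ler_pdivlMr ?ltr0n // mulrC ler_pdivrMr ?ltr0n //.
  by rewrite -natrM ler_nat overlap.
under eq_bigr do rewrite -mulr_suml -mulr_sumr sum_aw mulr1.
rewrite /hit_nbr mulr_suml mulr_sumr [leRHS]big_mkcond; apply: ler_sum => x' _.
rewrite /aw; case: (e x x'); last by rewrite !mul0r.
by rewrite /= mul1r mulrC mulrA.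
Qed.

End Pair.

Let swap (o : route) : route :=
  ((((o.1.1.1.2, o.1.1.1.1), o.1.1.2), o.2), o.1.2).

Lemma route_hit x y v :
  (forall x' y', e x x' -> e y y' -> (#|B x'| <= 2 * #|B x' :&: B y'|)%N) ->
  (forall x' y', e x x' -> e y y' -> (#|B y'| <= 2 * #|B x' :&: B y'|)%N) ->
  \sum_o route_weight x y o * (v \in route_verts o)%:R <=
    2 * (hit_nbr R e d k x v + hit_nbr R e d k y v).
Proof.
move=> ov1 ov2.
apply: (@le_trans _ _ (\sum_o route_weight x y o * (v \in o.1.2)%:R +
    \sum_o route_weight x y o * (v \in o.2)%:R)).
  rewrite -big_split; apply: ler_sum => o _ /=; rewrite -mulrDr.
  rewrite ler_wpM2l ?route_weight_ge0 // -natrD ler_nat inE.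
  by case: (_ \in _); case: (_ \in _).
rewrite mulrDr lerD ?route_hit_first //.
have swapK : involutive swap by move=> [[[[a b] c] S] S'].
rewrite (reindex_inj (inv_inj swapK)) /=.
apply: le_trans (@route_hit_first y x _ v); last first.
  by move=> x' y' yx' xy'; rewrite setIC; apply: ov2.
rewrite le_eqVlt; apply/orP; left; apply/eqP; apply: eq_bigr => -[[[[a b] c] S] S'] _.
rewrite /route_weight /= /cw setIC; congr (_ * _).
by rewrite [aw x _ * _]mulrC mulrAC.
Qed.

Lemma route_weight_connect x y o : 0 < route_weight x y o ->
  exists x' y', [/\ e x x', e y y', x' \in route_verts o, y' \in route_verts o
    & connect (induced e (route_verts o)) x' y'].
Proof.
case: o => [[[[x' y'] z] S] S']; rewrite /route_weight /route_verts /=.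
rewrite /aw /cw /jw.
case xx': (e x x'); last by rewrite !mul0r ltxx.
case yy': (e y y'); last by rewrite !(mul0r, mulr0) ltxx.
case SJ: (S \in J x' z); last by rewrite !(mul0r, mulr0) ltxx.
case SJ': (S' \in J y' z); last by rewrite !(mul0r, mulr0) ltxx.
move=> _; exists x', y'.
move: SJ SJ'; rewrite !inE => /and3P[_ xS cS] /and3P[_ yS cS'].
have widen (A A' : {set T}) u v : A \subset A' -> connect (induced e A) u v ->
    connect (induced e A') u v.
  move=> /subsetP AA'; apply: connect_sub => a b /and3P[aA bA ab].
  by apply: connect1; apply/and3P; split=> //; apply: AA'.
rewrite xS yS orbT; split=> //.
apply: connect_trans (widen _ _ _ _ (subsetUl S S') cS) _.
have ind_sym : connect_sym (induced e (S :|: S')).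
  apply: sym_connect_sym => a b.
  by apply/and3P/and3P => -[aS bS ab]; split; rewrite // e_sym.
rewrite ind_sym; exact: widen (subsetUr S S') cS'.
Qed.

Lemma route_weight_card x y o : 0 < route_weight x y o ->
  (#|route_verts o| <= 2 * r)%N.
Proof.
case: o => [[[[x' y'] z] S] S']; rewrite /route_weight /route_verts /= /jw.
case SJ: (S \in J x' z); last by rewrite !(mul0r, mulr0) ltxx.
case SJ': (S' \in J y' z); last by rewrite !(mul0r, mulr0) ltxx.
move: SJ SJ'; rewrite !inE => /and3P[cS _ _] /and3P[cS' _ _] _.
by rewrite cardsU (leq_trans (leq_subr _ _)) // mul2n -addnn leq_add.
Qed.

(** Conditioning a route on avoiding [U] at most doubles its probabilities.  The
    expected number of vertices shared by route [i] with the other routes is then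
    at most [2 * r * (4 * L) <= 1 / 4], which the local lemma accepts. *)
Lemma exists_disjoint_routes (I : finType) (src tgt : I -> T) (U : {set T}) (L : R) :
  (forall i x' y', e (src i) x' -> e (tgt i) y' -> (#|B x'| <= 2 * #|B x' :&: B y'|)%N) ->
  (forall i x' y', e (src i) x' -> e (tgt i) y' -> (#|B y'| <= 2 * #|B x' :&: B y'|)%N) ->
  32 * r%:R * L <= 1 ->
  (forall v, \sum_i (hit_nbr R e d k (src i) v + hit_nbr R e d k (tgt i) v) <= L) ->
  (forall i, \sum_(u in U) (hit_nbr R e d k (src i) u + hit_nbr R e d k (tgt i) u) <= L) ->
  exists F : I -> {set T},
    [/\ forall i, [disjoint F i & U], forall i, (#|F i| <= 2 * r)%N,
        forall i, exists x' y', [/\ e (src i) x', e (tgt i) y', x' \in F i, y' \in F i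
          & connect (induced e (F i)) x' y']
      & forall i j, i != j -> [disjoint F i & F j]].
Proof.
move=> ov1 ov2 rL load_v load_U.
have r1 : 1 <= r%:R :> R by rewrite ler1n.
have L4 : 4 * L <= 1.
  have [L0|L0] := leP 0 L; last by lra.
  by apply: le_trans rL; rewrite -mulrA; nra.
pose w (i : I) (o : route) := route_weight (src i) (tgt i) o.
pose ok (o : route) := [disjoint route_verts o & U].
pose m i := \sum_(o | ok o) w i o.
have w0 i o : 0 <= w i o by apply: route_weight_ge0.
have m_ge i : 2^-1 <= m i.
  have sum1 : m i + \sum_(o | ~~ ok o) w i o = 1.
    by rewrite -(sum_route_weight (@ov1 i)) [RHS](bigID ok).
  suff le2L : \sum_(o | ~~ ok o) w i o <= 2 * L.
    have := L4; move: sum1 le2L; clear; move: (m i) (\sum_(o | _) _) => x y.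
    by lra.
  apply: (@le_trans _ _ (\sum_o \sum_(u in U) w i o * (u \in route_verts o)%:R)).
    rewrite [leLHS]big_mkcond; apply: ler_sum => o _ /=.
    have [_|/pred0Pn[u /= /andP[uo uU]]] := boolP (ok o).
      by apply: sumr_ge0 => u _; rewrite mulr_ge0.
    rewrite (bigD1 u) //= uo mulr1 lerDl; apply: sumr_ge0 => v _.
    by rewrite mulr_ge0.
  rewrite exchange_big /=.
  apply: (@le_trans _ _ (\sum_(u in U) 2 * (hit_nbr R e d k (src i) u + hit_nbr R e d k (tgt i) u))).
    by apply: ler_sum => u _; apply: route_hit; [exact: ov1|exact: ov2].
  by rewrite -mulr_sumr ler_wpM2l.
have m0 i : 0 < m i by apply: lt_le_trans (m_ge i); rewrite invr_gt0.
pose mu i o : R := if ok o then w i o / m i else 0.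
have mu0 i o : 0 <= mu i o by rewrite /mu; case: ifP => // _; rewrite divr_ge0 // ltW.
have mu_le i o : mu i o <= 2 * w i o.
  rewrite /mu; case: ifP => _; last by rewrite mulr_ge0.
  rewrite ler_pdivrMr // mulrAC -[leLHS]mul1r ler_wpM2r //.
  by have := m_ge i; lra.
have mu1 i : \sum_o mu i o = 1.
  rewrite /mu -big_mkcond /= -mulr_suml -/(m i) mulfV //.
  by apply: lt0r_neq0.
pose conf (o o' : route) := ~~ [disjoint route_verts o & route_verts o'].
have conf_sym : symmetric conf by move=> o o'; rewrite /conf disjoint_sym.
have muL v : \sum_j \sum_o mu j o * (v \in route_verts o)%:R <= 4 * L.
  apply: (@le_trans _ _ (\sum_j 4 * (hit_nbr R e d k (src j) v + hit_nbr R e d k (tgt j) v))).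
    apply: ler_sum => j _.
    apply: (@le_trans _ _ (\sum_o 2 * (w j o * (v \in route_verts o)%:R))).
      by apply: ler_sum => o _; rewrite mulrA ler_wpM2r.
    rewrite -mulr_sumr; have := @route_hit (src j) (tgt j) v (@ov1 j) (@ov2 j).
    by rewrite -/(w j); lra.
  by rewrite -mulr_sumr ler_wpM2l.
have conf_small i : \sum_(j | j != i) \sum_o \sum_(o' | conf o o') mu i o * mu j o' <= 4^-1.
  apply: (@le_trans _ _ (\sum_j \sum_o \sum_o' \sum_v
      (mu i o * (v \in route_verts o)%:R) * (mu j o' * (v \in route_verts o')%:R))).
    rewrite [leLHS]big_mkcond; apply: ler_sum => j _.
    have ge0 o o' v : 0 <= (mu i o * (v \in route_verts o)%:R) * (mu j o' * (v \in route_verts o')%:R).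
      by rewrite !mulr_ge0.
    case: ifP => _; last by do 3!(apply: sumr_ge0 => ? _).
    apply: ler_sum => o _; rewrite [leLHS]big_mkcond; apply: ler_sum => o' _.
    case: ifP => [/pred0Pn[v /andP[/= vo vo']]|_]; last exact: sumr_ge0.
    by rewrite (bigD1 v) //= vo vo' !mulr1 lerDl sumr_ge0.
  have -> : \sum_j \sum_o \sum_o' \sum_v
      (mu i o * (v \in route_verts o)%:R) * (mu j o' * (v \in route_verts o')%:R) =
      \sum_v (\sum_o mu i o * (v \in route_verts o)%:R) *
         (\sum_j \sum_o' mu j o' * (v \in route_verts o')%:R).
    rewrite [RHS](eq_bigr (fun v => \sum_j \sum_o \sum_o'
      (mu i o * (v \in route_verts o)%:R) * (mu j o' * (v \in route_verts o')%:R))); last first.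
      move=> v _; rewrite mulr_sumr; apply: eq_bigr => j _.
      by rewrite mulr_suml; apply: eq_bigr => o _; rewrite mulr_sumr.
    rewrite [RHS]exchange_big; apply: eq_bigr => j _ /=.
    rewrite [RHS]exchange_big; apply: eq_bigr => o _ /=.
    by rewrite [RHS]exchange_big.
  apply: (@le_trans _ _ (\sum_v (\sum_o mu i o * (v \in route_verts o)%:R) * (4 * L))).
    apply: ler_sum => v _; rewrite ler_wpM2l // sumr_ge0 // => o _; exact: mulr_ge0.
  rewrite -mulr_suml exchange_big /=.
  have L0 : 0 <= L.
    apply: le_trans (load_U i); apply: sumr_ge0 => u _.
    by rewrite addr_ge0 // hit_nbr_ge0.
  apply: (@le_trans _ _ ((2 * r)%:R * (4 * L))).
    rewrite ler_wpM2r ?mulr_ge0 //.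
    have -> : (2 * r)%:R = \sum_o mu i o * (2 * r)%:R by rewrite -mulr_suml mu1 mul1r.
    apply: ler_sum => o _; rewrite -mulr_sumr sum_ind.
    have [->|mN0] := eqVneq (mu i o) 0; first by rewrite !mul0r.
    rewrite ler_wpM2l // ler_nat; apply: (@route_weight_card (src i) (tgt i)).
    rewrite lt_neqAle w0 andbT eq_sym; apply: contraNneq mN0 => w0'.
    by rewrite /mu /w w0' mul0r; case: ifP.
  by rewrite natrM; lra.
have [f [f0 fC]] := exists_conflict_free mu0 mu1 conf_sym conf_small.
have wf i : 0 < w i (f i).
  have := lt_le_trans (f0 i) (mu_le i (f i)); rewrite pmulr_rgt0 //.
exists (fun i => route_verts (f i)); split.
- by move=> i; have := f0 i; rewrite /mu; case: ifP => //; rewrite ltxx.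
- by move=> i; apply: route_weight_card (wf i).
- by move=> i; apply: route_weight_connect (wf i).
- by move=> i j /fC; rewrite negbK.
Qed.

End Routes.

(** * Random hubs *)

Section Hubs.
Variable R : realType.

Lemma expR_le_1D2x (x : R) : 0 <= x -> x <= 2^-1 -> expR x <= 1 + 2 * x.
Proof.
move=> x0 x2; have : 1 - x <= (expR x)^-1 by rewrite -expRN expR_ge1Dx.
have e0 := expR_gt0 x.
move=> le; have : (1 - x) * expR x <= 1 by rewrite -ler_pdivlMr // div1r.
by nra.
Qed.

Lemma expR1_le4 : expR 1 <= 4 :> R.
Proof.
have -> : 1 = 2^-1 + 2^-1 :> R by lra.
have h : expR 2^-1 <= 2 :> R by apply: le_trans (expR_le_1D2x _ _) _; lra.
rewrite expRD; have := expR_gt0 (2^-1 : R); nra.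
Qed.

Lemma expRN1_le : expR (- 1) <= 2^-1 :> R.
Proof.
by rewrite expRN lef_pV2 ?posrE ?expR_gt0 //; have := expR_ge1Dx (1 : R); lra.
Qed.

Variables (T : finType).

Lemma exists_colouring_unif (I : finType) (Q : nat) (J : I -> {set 'I_Q.+1})
    (w : I -> T -> R) (tau : I -> R) (x : R) :
  #|I|%:R * expR (- x) < 1 ->
  (forall i, \sum_u #|J i|%:R / Q.+1%:R * (expR (w i u) - 1) + x <= tau i) ->
  exists c : T -> 'I_Q.+1, forall i, \sum_(u | c u \in J i) w i u <= tau i.
Proof.
move=> lt1 le_tau; apply: exists_colouring; apply: le_lt_trans lt1.
rewrite mulr_natl -sumr_const; apply: ler_sum => i _.
by rewrite ler_expR; have := le_tau i; lra.
Qed.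

Variables (e : rel T) (d : nat).
Hypotheses (e_sym : symmetric e) (e_reg : regular_graph e d).

Lemma sum_nbr (F : bool -> R) v : F false = 0 -> \sum_u F (e v u) = d%:R * F true.
Proof.
move=> F0; rewrite (bigID (e v)) /= [X in _ + X]big1 ?addr0; last first.
  by move=> u /negPf ->.
rewrite (eq_bigr (fun=> F true)); last by move=> u ->.
rewrite sumr_const mulr_natl; congr (_ *+ _); rewrite -(e_reg v).
by apply: eq_card => u; rewrite inE.
Qed.

Lemma sum_card_nbr (A : {set T}) v :
  \sum_(u in A) ((e v u)%:R : R) = #|[set u in A | e v u]|%:R.
Proof.
rewrite -natr_sum -big_mkcondr sum1dep_card; congr _%:R.
Qed.

Lemma nbr_count_total (A : {set T}) :
  \sum_v (#|[set u in A | e v u]|%:R : R) = d%:R * #|A|%:R.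
Proof.
transitivity (\sum_v \sum_(u in A) ((e v u)%:R : R)).
  by apply: eq_bigr => v _; rewrite sum_card_nbr.
rewrite exchange_big /= mulr_natr -sumr_const; apply: eq_bigr => u _.
under eq_bigr do rewrite e_sym.
by rewrite (@sum_nbr (fun b => b%:R)) // mulr1.
Qed.

Variable k : nat.
Hypotheses (e_trans : vertex_transitive e).
Let r := k.+1.
Let l : R := ln #|T|%:R.

(** Colour the vertices with about [d / (8 ln n)] colours; [A] gets one colour and
    [B] gets [16], so that a vertex has on average [kappa] neighbours in [A] and
    [16 * kappa] in [B], and Hall's condition from [A] to [B] holds with room to
    spare.  The load conditions have weights at most [r / d], hence the scale
    [theta]; [274 = 17 * 16 + 2] collects the [17] colours and the margin [2 ln n]
    that beats the number of conditions. *)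
Lemma exists_hubs : (6 <= #|T|)%N -> 128 * r%:R ^+ 2 * (274 * l) <= d%:R ->
  exists (A B : {set T}) (kappa : R),
    [/\ [disjoint A & B], 8 * l <= kappa <= 16 * l,
        forall v, kappa / 4 <= #|[set u in A | e v u]|%:R <= 4 * kappa,
        forall v, 4 * kappa <= #|[set u in B | e v u]|%:R &
        forall v, \sum_(u in A :|: B) hit_nbr R e d k u v <= (64 * r%:R)^-1 /\
                  \sum_(u in A :|: B) hit_nbr R e d k v u <= (64 * r%:R)^-1].
Proof.
move=> n6 hd.
have n6R : 6 <= #|T|%:R :> R by rewrite (ler_nat _ 6).
have l0 : 0 < l by apply: ln_gt0; lra.
have r1 : 1 <= r%:R :> R by rewrite ler1n.
have dl : 136 * l <= d%:R.
  apply: le_trans hd; rewrite -[leLHS]mul1r; apply: ler_pM => //; first by lra.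
    by apply: mulr_ege1; rewrite ?exprn_ege1 // ler1n.
  by rewrite ler_wpM2r ?(ltW l0) // ler_nat.
have d0 : 0 < d%:R :> R by lra.
have d_gt0 : (0 < d)%N by rewrite ltr0n in d0.
pose D : R := d%:R / (8 * l).
have D17 : 17 <= D by rewrite ler_pdivlMr; lra.
have D0 : 0 <= D by apply: le_trans D17; rewrite ler0n.
have /andP[qD Dq] := truncn_itv D0.
case Qq : (Num.truncn D) => [|Q]; first by move: Dq; rewrite Qq; lra.
rewrite Qq in qD Dq.
have Q17 : (17 <= Q.+1)%N.
  by rewrite -(ler_nat R) leNgt; apply/negP; rewrite ltr_nat => lt;
     have : Q.+2%:R <= 17%:R :> R; [rewrite ler_nat | lra].
set q : R := Q.+1%:R.
have q1 : 1 <= q by rewrite ler1n.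
pose kappa : R := d%:R / q.
have kq : kappa * q = d%:R by rewrite divfK // gt_eqF //; lra.
have kappa_lo : 8 * l <= kappa.
  rewrite ler_pdivlMr; last by lra.
  by move: qD; rewrite ler_pdivlMr -/q; lra.
have kappa_hi : kappa <= 16 * l.
  rewrite ler_pdivrMr; last by lra.
  have : D < 2 * q by move: Dq; rewrite -natr1 -/q; lra.
  by rewrite ltr_pdivrMr; lra.
have k0 : 0 < kappa by apply: lt_le_trans kappa_lo; apply: mulr_gt0; rewrite ?ltr0n.
pose JA : {set 'I_Q.+1} := [set ord0].
pose JB : {set 'I_Q.+1} := [set i : 'I_Q.+1 | (0 < i < 17)%N].
have cA : #|JA| = 1%N by rewrite cards1.
have cAB : #|JA :|: JB| = 17%N.
  have -> : JA :|: JB = [set widen_ord Q17 i | i : 'I_17].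
    apply/setP => i; rewrite !inE -val_eqE /=; apply/idP/imsetP => [i17|[j _ ->]].
      have lti : (i < 17)%N by case: (nat_of_ord i) i17.
      by exists (Ordinal lti) => //; apply: val_inj.
    by rewrite /=; case: j => [[]].
  by rewrite card_imset ?card_ord // => i j /(congr1 val) /= /val_inj.
have dAB : [disjoint JA & JB].
  by apply/pred0P => i /=; rewrite !inE; apply/negbTE/negP => /andP[/eqP ->].
have cB : #|JB| = 16%N.
  have := cardsU JA JB; rewrite (disjoint_setI0 dAB) cards0 subn0 cAB cA add1n.
  by case=> ->.
pose theta : R := d%:R / (2 * r%:R).
have theta0 : 0 <= theta by rewrite divr_ge0 // ?mulr_ge0 //.
pose J (i : T * 'I_5) := match val i.2 with
  | 0%N | 1%N => JA | 2%N => JB | _ => JA :|: JB end.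
pose w (i : T * 'I_5) (u : T) : R := match val i.2 with
  | 0%N => - (e i.1 u)%:R | 1%N => (e i.1 u)%:R | 2%N => - (e i.1 u)%:R
  | 3%N => theta * hit_nbr R e d k u i.1
  | _ => theta * hit_nbr R e d k i.1 u end.
pose tau (i : T * 'I_5) : R := match val i.2 with
  | 0%N => - (kappa / 4) | 1%N => 4 * kappa | 2%N => - (4 * kappa)
  | _ => theta * (64 * r%:R)^-1 end.
have load (h : T -> R) : (forall u, 0 <= h u <= r%:R / d%:R) -> \sum_u h u <= r%:R ->
    \sum_u 17%:R / q * (expR (theta * h u) - 1) + 2 * l <= theta * (64 * r%:R)^-1.
  move=> hle hsum.
  have le1 u : expR (theta * h u) - 1 <= 2 * (theta * h u).
    have /andP[h0 h1] := hle u.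
    rewrite lerBlDl; apply: expR_le_1D2x; first exact: mulr_ge0.
    apply: le_trans (ler_wpM2l theta0 h1) _.
    rewrite /theta le_eqVlt; apply/orP; left; apply/eqP; field.
    by rewrite !gt_eqF //; lra.
  apply: (@le_trans _ _ (17 * kappa + 2 * l)).
    rewrite lerD2r; apply: (@le_trans _ _ (\sum_u 17%:R / q * (2 * theta) * h u)).
      apply: ler_sum => u _; rewrite -[leRHS]mulrA; apply: ler_wpM2l.
        by apply: divr_ge0; [exact: ler0n|exact: ler0n].
      by rewrite -[leRHS]mulrA; apply: le1.
    rewrite -[leLHS]mulr_sumr.
    apply: le_trans (ler_wpM2l _ hsum) _.
      by rewrite mulr_ge0 ?divr_ge0 ?mulr_ge0 //; lra.
    rewrite /theta /kappa le_eqVlt; apply/orP; left; apply/eqP; field.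
    by rewrite !gt_eqF //; lra.
  have -> : theta * (64 * r%:R)^-1 = d%:R / (128 * r%:R ^+ 2).
    by rewrite /theta; field; rewrite !gt_eqF //; lra.
  rewrite ler_pdivlMr; last by rewrite mulr_gt0 // exprn_gt0 //; lra.
  apply: le_trans hd.
  have : 17 * kappa + 2 * l <= 274 * l by lra.
  have : 0 < r%:R ^+ 2 :> R by rewrite exprn_gt0 //; lra.
  by nra.
have [||c hc] := @exists_colouring_unif _ Q J w tau (2 * l).
- rewrite card_prod card_ord natrM.
  have -> : expR (- (2 * l)) = (#|T|%:R ^+ 2)^-1.
    have -> : 2 * l = l + l by ring.
    by rewrite expRN expRD lnK ?posrE ?expr2 //; lra.
  rewrite ltr_pdivrMr ?exprn_gt0 // ?mul1r ?expr2; first by nra.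
  by lra.
- have T1 : true%:R = 1 :> R by [].
  have EN : kappa * expR (- 1) <= kappa * 2^-1 by rewrite ler_wpM2l ?expRN1_le // ltW.
  have EP : kappa * expR 1 <= kappa * 4 by rewrite ler_wpM2l ?expR1_le4 // ltW.
  have dq p (E : R) : p / Q.+1%:R * (d%:R * (E - 1)) = p * (kappa * E - kappa).
    by rewrite -/q -kq; field; rewrite gt_eqF //; apply: lt_le_trans q1.
  case=> v [[|[|[|[|[|//]]]]] i5]; rewrite /J /w /tau /=.
  + rewrite cA -mulr_sumr (@sum_nbr (fun b => expR (- b%:R) - 1)); last first.
      by rewrite oppr0 expR0 subrr.
    by rewrite T1 dq mul1r; lra.
  + rewrite cA -mulr_sumr (@sum_nbr (fun b => expR (b%:R) - 1)); last first.
      by rewrite expR0 subrr.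
    by rewrite T1 dq mul1r; lra.
  + rewrite cB -mulr_sumr (@sum_nbr (fun b => expR (- b%:R) - 1)); last first.
      by rewrite oppr0 expR0 subrr.
    by rewrite T1 dq; lra.
  + rewrite cAB; apply: load; last exact: load_hit_nbr.
    by move=> u; rewrite hit_nbr_ge0 hit_nbr_le.
  + rewrite cAB; apply: load; last exact: sum_hit_nbr.
    by move=> u; rewrite hit_nbr_ge0 hit_nbr_le.
pose A := [set u | c u \in JA]; pose B := [set u | c u \in JB].
have inA u : (u \in A) = (c u \in JA) by rewrite inE.
have inB u : (u \in B) = (c u \in JB) by rewrite inE.
have inAB u : (u \in A :|: B) = (c u \in JA :|: JB) by rewrite in_setU inA inB in_setU.
have cond i (lt : (i < 5)%N) v := hc (v, Ordinal lt).
exists A, B, kappa; split=> //.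
- apply/pred0P => u /=; rewrite inA inB.
  by have /pred0P/(_ (c u)) := dAB.
- by rewrite kappa_lo.
- move=> v; have := cond 0%N isT v; have := cond 1%N isT v.
  rewrite /J /w /tau /= sumrN -!(eq_bigl _ _ inA) sum_card_nbr; lra.
- move=> v; have := cond 2%N isT v.
  rewrite /J /w /tau /= sumrN -!(eq_bigl _ _ inB) sum_card_nbr; lra.
- have theta_gt0 : 0 < theta by rewrite divr_gt0 // mulr_gt0 // ltr0n.
  move=> v; have := cond 3%N isT v; have := cond 4%N isT v.
  rewrite /J /w /tau /= -!(eq_bigl _ _ inAB) -!mulr_sumr.
  by rewrite !ler_pM2l.
Qed.

End Hubs.

(** * Sweeping a ladder *)

Ltac lia_count :=
  change (nat_of_bool true) with 1%N; change (nat_of_bool false) with 0%N;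
  repeat match goal with
  | |- context [nat_of_bool ?b] => move: (nat_of_bool b) => ?
  | |- context [count ?a ?s] => move: (count a s) => ?
  end; clear; lia.

Section Sweep.
Local Open Scope nat_scope.
Variables (T : finType) (e : rel T).
Hypothesis e_sym : symmetric e.

(** One step of a ladder: the inner vertices of the two rails, then the next rung. *)
Definition rung_step : Type := (seq T * seq T) * (T * T).

Fixpoint ladder (a b : T) (L : seq rung_step) : Prop :=
  if L is ((rA, rB), (a', b')) :: L' then
    [/\ path e a (rcons rA a'), path e b (rcons rB b'), e a' b' & ladder a' b' L']
  else True.

Definition ladder_verts (L : seq rung_step) : seq T :=
  flatten [seq s.1.1 ++ s.1.2 ++ [:: s.2.1; s.2.2] | s <- L].
Definition ladder_feet (a : T) (L : seq rung_step) : seq T :=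
  a :: [seq s.2.1 | s <- L].
Definition ladder_end (b : T) (L : seq rung_step) : T :=
  last b [seq s.2.2 | s <- L].

Definition chord : Type := (T * T) * seq T.
Definition chord_ends (C : seq chord) : seq T :=
  flatten [seq [:: c.1.1; c.1.2] | c <- C].
Definition chord_verts (C : seq chord) : seq T := flatten [seq c.2 | c <- C].
Definition is_chord (c : chord) : bool := path e c.1.1 (rcons c.2 c.1.2).

Lemma path_rcons_rev (x y : T) p :
  path e x (rcons p y) = path e y (rcons (rev p) x).
Proof.
have := rev_path e x (rcons p y).
rewrite last_rcons belast_rcons rev_cons => ->.
by apply: eq_path => u v; rewrite e_sym.
Qed.

Lemma uniq_count (s : seq T) : uniq s <-> forall x, count_mem x s <= 1.
Proof.
split=> [us x|]; first by rewrite count_uniq_mem // leq_b1.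
elim: s => //= y s IHs H; apply/andP; split.
  have := H y; rewrite /= eqxx add1n ltnS leqn0 => /eqP c0.
  by rewrite -has_pred1 has_count c0.
by apply: IHs => x; apply: leq_trans (H x); rewrite leq_addl.
Qed.

Lemma mem_count (s : seq T) x : (x \in s) = (0 < count_mem x s).
Proof. by rewrite -has_pred1 has_count. Qed.

Lemma chord_at (C : seq chord) a : all is_chord C -> a \in chord_ends C ->
  exists t p C', [/\ is_chord ((a, t), p), all is_chord C',
    (forall x, count_mem x (chord_ends C) = count_mem x (a :: t :: chord_ends C')) &
    (forall x, count_mem x (chord_verts C) = count_mem x (p ++ chord_verts C'))].
Proof.
elim: C => //= -[[s t] p] C IHC /= /andP[cc cC].
rewrite /chord_ends /= !inE -/(chord_ends C) => /or3P[/eqP->|/eqP->|/IHC].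
- by exists t, p, C.
- exists s, (rev p), C; split=> //.
  + by rewrite /is_chord /= -path_rcons_rev.
  + by move=> x /=; rewrite addnCA.
  + by move=> x; rewrite /chord_verts /= !count_cat count_rev.
case=> // t' [p' [C' [c1 c2 e1 e2]]].
exists t', p', (((s, t), p) :: C'); split=> //=.
- by rewrite cc.
- move=> x; rewrite -/(chord_ends C) /chord_ends /= -/(chord_ends C') e1 /=; lia_count.
- by move=> x; rewrite /chord_verts /= -/(chord_verts C) -/(chord_verts C') !count_cat e2 !count_cat; lia_count.
Qed.

(** The foot of the current rung, as long as a chord waits there: a foot that was
    used to absorb a chord is already on the current path. *)
Definition pending (a : T) (C : seq chord) : seq T :=
  if a \in chord_ends C then [:: a] else [::].

Lemma count_pending x a C : count_mem x (pending a C) <= (a == x).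
Proof. by rewrite /pending; case: ifP => _; rewrite /= ?addn0. Qed.

(** Induction on the ladder, [D] being the path built so far along the top rail.  If no
    chord ends at the foot [a], [D] just moves on.  Otherwise the chord at [a] ends
    at the next foot [a'] and is absorbed by [D], or meets another chord at [a'] and
    is joined to it, or is prolonged along the foot rail to [a'].  At the last rung
    no chord is left, since its two ends would be distinct and both equal to the
    last foot. *)
Lemma sweep_ladder L a b x0 D C : ladder a b L -> e a b ->
  path e x0 D -> last x0 D = b -> all is_chord C ->
  {subset chord_ends C <= ladder_feet a L} -> uniq (chord_ends C) ->
  uniq ((x0 :: D) ++ pending a C ++ ladder_verts L ++ chord_verts C) ->
  exists D', [/\ path e x0 D', last x0 D' = ladder_end b L, uniq (x0 :: D'),
    {subset D ++ chord_verts C <= x0 :: D'} &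
    {subset D' <= D ++ a :: ladder_verts L ++ chord_verts C}].
Proof.
elim: L a b D C => [|[[rA rB] [a' b']] L IHL] a b D C.
  move=> _ eab pD lD cC sC uC /uniq_count uD.
  have C0 : C = [::].
    case: C sC uC {cC uD} => // -[[s t] p] C sC /=.
    have /eqP -> : s == a by have := sC s; rewrite !inE eqxx => ->.
    have /eqP -> : t == a by have := sC t; rewrite !inE eqxx orbT => ->.
    by rewrite inE eqxx.
  subst C; exists D; split=> //.
  - by apply/uniq_count => x; have := uD x; rewrite !count_cat /=; lia_count.
  - by move=> x; rewrite cats0 inE => ->; rewrite orbT.
  - by move=> x; rewrite mem_cat => ->.
move=> [pA pB eab' lad] eab pD lD cC sC uC /uniq_count uD.
have vE x : count_mem x (ladder_verts (((rA, rB), (a', b')) :: L)) =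
    count_mem x rA + (count_mem x rB + ((a' == x) + ((b' == x) + count_mem x (ladder_verts L)))).
  by rewrite /ladder_verts /= !count_cat /= addn0 !addnA.
move: (ladder_verts (((rA, rB), (a', b')) :: L)) vE uD => V vE uD.
have cE y (s : seq T) x : count_mem x (y :: s) = (y == x) + count_mem x s by [].
(* in all cases below, [D1] and [C1] are the next path and the next chords *)
have step D1 C1 : path e x0 D1 -> last x0 D1 = b' -> all is_chord C1 ->
    {subset chord_ends C1 <= ladder_feet a' L} -> uniq (chord_ends C1) ->
    (forall x, count_mem x D1 + count_mem x (chord_verts C1) + count_mem x (pending a' C1) <=
       count_mem x D + count_mem x (chord_verts C) + count_mem x (pending a C) + count_mem x rA +
         count_mem x rB + (a' == x) + (b' == x)) ->
    (forall x, count_mem x D + count_mem x (chord_verts C) <=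
       count_mem x D1 + count_mem x (chord_verts C1)) ->
    exists D', [/\ path e x0 D', last x0 D' = ladder_end b (((rA, rB), (a', b')) :: L),
      uniq (x0 :: D'), {subset D ++ chord_verts C <= x0 :: D'} &
      {subset D' <= D ++ a :: V ++ chord_verts C}].
  move=> pD1 lD1 cC1 sC1 uC1 up down.
  have [|D' [q1 q2 q3 q4 q5]] := IHL a' b' D1 C1 lad eab' pD1 lD1 cC1 sC1 uC1.
    apply/uniq_count => x; have := up x; have := uD x.
    by rewrite !(count_cat, cE) vE; lia_count.
  exists D'; split=> //.
  - move=> x; rewrite mem_count => H; apply: q4.
    by rewrite mem_count; have := down x; move: H; rewrite !count_cat; lia_count.
  - move=> x /q5; rewrite !mem_count; have := up x; have := count_pending x a C.
    by rewrite !(count_cat, cE) vE; lia_count.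
have pDB : path e x0 (D ++ rcons rB b') by rewrite cat_path pD lD.
have lDB : last x0 (D ++ rcons rB b') = b' by rewrite last_cat last_rcons.
have feet_cons s : s \in ladder_feet a (((rA, rB), (a', b')) :: L) ->
    s != a -> s \in ladder_feet a' L.
  by rewrite /ladder_feet /= inE => /orP[/eqP ->|//]; rewrite eqxx.
have [aC|aC] := boolP (a \in chord_ends C); last first.
  apply: (step (D ++ rcons rB b') C) => //.
  - move=> s sC'; apply: feet_cons; first exact: sC.
    by apply: contraNneq aC => <-.
  - by move=> x; rewrite count_cat -cats1 count_cat /=; have := count_pending x a' C; lia_count.
  - by move=> x; rewrite count_cat; lia_count.
have pE x : count_mem x (pending a C) = (a == x) by rewrite /pending aC /= addn0.
have [t [p [C' [cp cC' eE vE']]]] := chord_at cC aC.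
have {}uC : forall x, count_mem x (a :: t :: chord_ends C') <= 1.
  by move=> x; rewrite -eE; move/uniq_count: uC => /(_ x).
have uC' : uniq (chord_ends C').
  by apply/uniq_count => x; have := uC x => /=; lia_count.
have ta : t != a.
  by apply/eqP => ta; have := uC a; rewrite ta /= eqxx.
have sC' : {subset t :: chord_ends C' <= ladder_feet a' L}.
  move=> s sC'; apply: feet_cons.
    by apply: sC; rewrite mem_count eE /=; move: sC'; rewrite mem_count /=; lia_count.
  apply/eqP => sa; have := uC a; move: sC'; rewrite sa mem_count /= eqxx /=; lia_count.
have [ta'|ta'] := eqVneq t a'.
  subst t; apply: (step (D ++ a :: p ++ [:: a'; b']) C') => //.
  - rewrite cat_path pD lD /= (e_sym b a) eab /=.
    by move: cp; rewrite /is_chord /= rcons_path cat_path /= eab' andbT => /andP[-> ->].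
  - by rewrite last_cat /= last_cat.
  - by move=> s sC1; apply: sC'; rewrite inE sC1 orbT.
  - have a'C : a' \notin chord_ends C'.
      by apply/negP => a'C; have := uC a'; move: a'C; rewrite mem_count /= eqxx /=; lia_count.
    move=> x; rewrite pE /pending (negPf a'C) vE' !count_cat /= !count_cat /=; lia_count.
  - by move=> x; rewrite vE' !count_cat /= !count_cat /=; lia_count.
have [a'C|a'C] := boolP (a' \in chord_ends C'); last first.
  apply: (step (D ++ rcons rB b') (((a', t), rev rA ++ a :: p) :: C')) => //.
  - rewrite /= cC' andbT /is_chord /= rcons_cat rcons_cons cat_path /=.
    move: cp; rewrite /is_chord /= => ->.
    move: pA; rewrite path_rcons_rev rcons_path => /andP[-> ->].
    by [].
  - move=> s; rewrite /chord_ends /= -/(chord_ends C') inE => /orP[/eqP ->|/sC'//].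
    by rewrite inE eqxx.
  - apply/uniq_count => x; rewrite /chord_ends /= -/(chord_ends C').
    have := uC x => /=; move: a'C; rewrite mem_count.
    have [<-|_] := eqVneq a' x; last by lia_count.
    by rewrite (negPf ta') /=; lia_count.
  - move=> x; have := count_pending x a' (((a', t), rev rA ++ a :: p) :: C').
    rewrite pE vE' /chord_verts /= -/(chord_verts C').
    by rewrite -cats1 !count_cat count_rev /=; lia_count.
  - move=> x; rewrite vE' /chord_verts /= -/(chord_verts C').
    by rewrite !count_cat /=; lia_count.
have [t' [p' [C'' [cp' cC'' eE' vE'']]]] := chord_at cC' a'C.
apply: (step (D ++ rcons rB b') (((t', t), rev p' ++ a' :: rev rA ++ a :: p) :: C'')) => //.
- rewrite /= cC'' andbT /is_chord /= rcons_cat rcons_cons cat_path /=.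
  rewrite rcons_cat rcons_cons cat_path /=.
  move: cp; rewrite /is_chord /= => ->.
  move: pA; rewrite path_rcons_rev rcons_path => /andP[-> ->].
  by move: cp'; rewrite /is_chord /= path_rcons_rev rcons_path => /andP[-> ->].
- move=> s; rewrite /chord_ends /= -/(chord_ends C'') !inE => /or3P[/eqP ->|/eqP ->|sC2].
  + by apply: sC'; rewrite inE mem_count eE' /= eqxx /=; lia_count.
  + by apply: sC'; rewrite inE eqxx.
  + by apply: sC'; rewrite inE mem_count eE' /=; move: sC2; rewrite mem_count; lia_count.
- apply/uniq_count => x; rewrite /chord_ends /= -/(chord_ends C'').
  by have := uC x; rewrite /= eE' /=; lia_count.
- move=> x; have a'N : a' \notin chord_ends (((t', t), rev p' ++ a' :: rev rA ++ a :: p) :: C'').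
    rewrite mem_count /chord_ends /= -/(chord_ends C'').
    have := uC a'; rewrite /= eE' /= eqxx /=; lia_count.
  rewrite pE /pending (negPf a'N) vE' (count_cat _ p) vE'' /chord_verts /= -/(chord_verts C'').
  by rewrite -cats1 !count_cat count_rev /= !count_cat /= count_rev; lia_count.
- move=> x; rewrite vE' (count_cat _ p) vE'' /chord_verts /= -/(chord_verts C'').
  by rewrite !count_cat /= !count_cat count_rev /=; lia_count.
Qed.

End Sweep.

(** * The ladder through the hubs *)

Section HubGeometry.
Local Open Scope nat_scope.
Variables (T : finType) (e : rel T).
Hypothesis e_sym : symmetric e.

Lemma hub_matching (R : realType) (A B : {set T}) (m : R) : (0 < m)%R ->
  (forall v, (m <= #|[set u in B | e v u]|%:R)%R) ->
  (forall v, (#|[set u in A | e v u]|%:R <= m)%R) ->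
  exists f : T -> T, {in A &, injective f} /\ {in A, forall x, f x \in B /\ e x (f x)}.
Proof.
move=> m0 hB hA; have [->|[x0 _]] := set_0Vmem A.
  by exists id; split=> x; rewrite inE.
have [S SA|f [fI fN]] := @hall T T x0 (fun v => [set u in B | e v u]) A.
  rewrite -(ler_nat R) -(ler_pM2r m0); apply: ler_card_neighbours => [v _|y]; first exact: hB.
  apply: le_trans (hA y); rewrite ler_nat.
  apply: subset_leq_card; apply/subsetP => v.
  rewrite [v \in _]inE => /andP[vS]; rewrite inE => /andP[_ vy].
  by rewrite inE e_sym vy (subsetP SA).
exists f; split=> // x /fN; rewrite inE => /andP[]; by split.
Qed.

(** Replace the vertices of a path by hubs that dominate them: consecutive ones are
    at distance at most [3]. *)
Lemma hub_connected (A : {set T}) : connected_graph e ->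
  (forall v, exists2 u, u \in A & e v u) ->
  {in A &, forall a a', connect (induced [rel u v | v \in ball e u 3] A) a a'}.
Proof.
move=> con dom a a' aA a'A.
suff H v : connect e a v ->
    forall b, b \in A -> b \in ball e v 1 -> connect (induced [rel u v | v \in ball e u 3] A) a b.
  by apply: (H _ (con a a') a' a'A); apply: ball_center.
case/connectP => p; elim/last_ind: p v => [|p w IHp] v.
  move=> _ -> b bA bv; apply: connect1; apply/and3P; split=> //.
  exact: (subsetP (subset_ball e a (isT : 1 <= 3))) bv.
rewrite rcons_path last_rcons => /andP[pp lw] -> b bA bw.
have [u uA lu] := dom (last a p).
apply: connect_trans (IHp _ pp erefl u uA (ball1 lu)) _.
apply: connect1; apply/and3P; split=> //.
have h1 : last a p \in ball e u 1 by apply: ball1; rewrite e_sym.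
by have := ball_trans (ball_trans h1 (ball1 lw)) bw.
Qed.

Lemma hub_order (A : {set T}) (x0 : T) : connected_graph e ->
  (forall v, exists2 u, u \in A & e v u) ->
  exists a s, [/\ uniq (a :: s), a :: s =i A,
    path [rel u v | v \in ball e u 9] a s & a \in ball e (last a s) 9].
Proof.
move=> con dom; have [a aA _] := dom x0.
pose h := [rel u v | v \in ball e u 3].
have h_refl : reflexive h by move=> u; apply: ball_center.
have h_sym : symmetric h by move=> u v; apply/idP/idP; exact: (ball_sym e_sym).
have [s [us sA ps ls]] := cube_order h_refl h_sym aA (fun b bA => hub_connected con dom aA bA).
exists a, s; split=> //.
  apply: sub_path ps => u v /existsP[x /existsP[y /and3P[ux xy yv]]].
  exact: ball_trans (ball_trans ux xy) yv.
have : a \in ball e (last a s) 3 by exact: (ball_sym e_sym).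
exact: (subsetP (subset_ball e _ (isT : 3 <= 9))).
Qed.

Lemma route_path (F : {set T}) x y :
  (exists x' y', [/\ e x x', e y y', x' \in F, y' \in F & connect (induced e F) x' y']) ->
  exists q, [/\ path e x (rcons q y), uniq q & {subset q <= F}].
Proof.
case=> x' [y' [xx' yy' x'F y'F /connectP[p pp lp]]].
case/shortenP: pp lp => p' pp' up' _ lp'.
exists (x' :: p'); split=> //.
  rewrite /= xx' rcons_path -lp' e_sym yy' andbT.
  by apply: sub_path pp' => u v /and3P[].
move=> z; rewrite inE => /orP[/eqP -> //|].
elim: p' x' pp' {xx' x'F up' lp'} => //= w p1 IHp x' /andP[/and3P[_ wF _] pp].
by rewrite inE => /orP[/eqP -> //|]; apply: IHp pp.
Qed.

End HubGeometry.

Section Network.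
Variables (R : realType) (T : finType) (e : rel T) (d : nat).
Hypotheses (e_sym : symmetric e) (e_reg : regular_graph e d).
Hypotheses (e_trans : vertex_transitive e) (e_con : connected_graph e).
Let l : R := ln #|T|%:R.
Let K := (13 * (trunc_log 2 #|T|).+1).+1.

Section Assemble.
Local Open Scope nat_scope.
Variables (a : T) (s : seq T) (f : T -> T) (rt : 'I_(size s).+1 * bool -> seq T).
Let c := a :: s.
Let pos (i : nat) := nth a c i.
Let step (i : nat) : rung_step T :=
  ((rt (inord i, true), rt (inord i, false)), (pos i.+1, f (pos i.+1))).

Definition hub_ladder : seq (rung_step T) := [seq step i | i <- iota 0 (size s)].

Lemma hub_ladder_feet : ladder_feet a hub_ladder = c.
Proof.
rewrite /ladder_feet /hub_ladder -map_comp /c; congr (_ :: _).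
by rewrite -[RHS]take_size -(map_nth_iota0 a (leqnn (size s))); apply: eq_map.
Qed.

Lemma hub_ladder_end : ladder_end (f a) hub_ladder = f (last a s).
Proof.
rewrite /ladder_end /hub_ladder -map_comp -[RHS](last_map f); congr last.
by rewrite -[in RHS](take_size s) -(map_nth_iota0 a (leqnn (size s))) -map_comp.
Qed.

Lemma count_hub_ladder (p : pred T) :
  (count p (a :: f a :: ladder_verts hub_ladder ++ rt (ord_max, false)) <=
   count p c + count p (map f c) + \sum_(i : 'I_(size s).+1) \sum_(b : bool) count p (rt (i, b))).
Proof.
have VE : count p (ladder_verts hub_ladder) =
    (count p s + count p (map f s) +
     \sum_(i < size s) \sum_(b : bool) count p (rt (inord i, b)))%N.
  have -> : count p s = \sum_(i < size s) p (pos i.+1).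
    rewrite -sum1_count big_mkcond (big_nth a) big_mkord; apply: eq_bigr => i _.
    by rewrite /pos /=; case: (p _).
  have -> : count p (map f s) = \sum_(i < size s) p (f (pos i.+1)).
    rewrite count_map -sum1_count big_mkcond (big_nth a) big_mkord.
    by apply: eq_bigr => i _; rewrite /pos /=; case: (p _).
  rewrite /ladder_verts /hub_ladder -map_comp count_flatten -map_comp sumnE big_map.
  rewrite -{1}(subn0 (size s)) -/(index_iota 0 (size s)) big_mkord -!big_split.
  apply: eq_bigr => i _ /=; rewrite !count_cat /= big_bool /= addn0.
  by rewrite [RHS]addnC addnA.
rewrite big_ord_recr /= count_cat VE big_bool /=.
have -> : \sum_(i < size s) \sum_(b : bool) count p (rt (inord i, b)) =
    \sum_(i < size s) \sum_(b : bool) count p (rt (widen_ord (leqnSn (size s)) i, b)).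
  apply: eq_bigr => i _; rewrite (_ : inord i = widen_ord (leqnSn (size s)) i) //.
  by apply: val_inj; rewrite /= inordK // ltnS ltnW.
by move: (\sum_(i < size s) _) => S; lia_count.
Qed.

Lemma hub_ladderP :
  (forall i : 'I_(size s).+1,
     path e (pos i) (rcons (rt (i, true)) (pos (ordS i)))) ->
  (forall i : 'I_(size s).+1,
     path e (f (pos i)) (rcons (rt (i, false)) (f (pos (ordS i))))) ->
  (forall i : 'I_(size s).+1, e (pos i) (f (pos i))) ->
  ladder e a (f a) hub_ladder.
Proof.
move=> pA pB pR; rewrite /hub_ladder -[a]/(pos 0).
have : 0 + size s = size s by [].
elim: {1 3}(size s) 0 => //= m IHm i im.
have si : ordS (inord i : 'I_(size s).+1) = i.+1 :> nat.
  by rewrite /= inordK; [rewrite modn_small // ltnS|]; lia.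
have ii : nat_of_ord (inord i : 'I_(size s).+1) = i by rewrite inordK; lia.
split.
- by have := pA (inord i); rewrite si ii.
- by have := pB (inord i); rewrite si ii.
- by have := pR (ordS (inord i)); rewrite si.
- by apply: IHm; rewrite addSnnS.
Qed.

End Assemble.

(** Hubs consecutive in the cyclic order are at distance at most [9], and so their
    partners are at distance at most [11].  With the two first steps of a route this
    makes [13], the step of the radii in [slow_growth].  Every hub is the start of
    one route and the end of another, so the load bound [1 / (64 r)] doubles to
    [1 / (32 r)]. *)
Lemma exists_ladder (eta : R) : (6 <= #|T|)%N ->
  128 * K%:R ^+ 2 * (274 * l) <= d%:R -> 384 * K%:R * l <= eta * d%:R ->
  exists a b L cl (A : {set T}),
    [/\ ladder e a b L, e a b /\ path e (ladder_end b L) (rcons cl b),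
        uniq (a :: b :: ladder_verts L ++ cl) /\ ladder_feet a L =i A,
        (size (a :: b :: ladder_verts L ++ cl))%:R <= eta * #|T|%:R
      & forall v, 2 * l <= #|[set u in A | e v u]|%:R].
Proof.
move=> n6 hd heta.
have [x0 _] : exists x0 : T, x0 \in T by apply/card_gt0P; apply: leq_trans n6.
have l1 : 1 <= l.
  rewrite -(expRK 1) ler_ln ?posrE ?expR_gt0 ?ltr0n ?(leq_trans _ n6) //.
  by apply: le_trans (expR1_le4 R) _; rewrite ler_nat (leq_trans _ n6).
have l0 : 0 < l by lra.
have [j lej slow] := slow_growth e x0 13.
pose k := (13 * j.+1)%N.
have kK : (k.+1 <= K)%N by rewrite /K /k; lia.
pose r : R := k.+1%:R; pose KR : R := K%:R.
have rK : r <= KR by rewrite ler_nat.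
have r1 : 1 <= r by rewrite ler1n.
have d0 : 0 < d%:R :> R.
  apply: lt_le_trans hd; apply: mulr_gt0.
    by apply: mulr_gt0; [rewrite ltr0n|apply: exprn_gt0; apply: lt_le_trans rK; lra].
  by apply: mulr_gt0; rewrite ?ltr0n.
have d_gt0 : (0 < d)%N by rewrite ltr0n in d0.
have hd' : 128 * r ^+ 2 * (274 * l) <= d%:R.
  apply: le_trans hd; apply: ler_wpM2r; first by apply: mulr_ge0; [rewrite ler0n|exact: ltW].
  by apply: ler_wpM2l; [rewrite ler0n|apply: lerXn2r; rewrite ?nnegrE ?ler0n].
have [A [B [kappa [dAB /andP[klo khi] hA hB hload]]]] :=
  exists_hubs e_sym e_reg e_trans n6 hd'.
rewrite -/l in klo khi.
have k0 : 0 < kappa by lra.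
have domA v : exists2 u, u \in A & e v u.
  case/andP: (hA v) => h _.
  have : 0 < #|[set u in A | e v u]|%:R :> R.
    by apply: lt_le_trans h; apply: divr_gt0; rewrite ?ltr0n.
  by rewrite ltr0n => /card_gt0P[u]; rewrite inE => /andP[uA vu]; exists u.
have [f [fI fB]] : exists f : T -> T,
    {in A &, injective f} /\ {in A, forall x, f x \in B /\ e x (f x)}.
  apply: (hub_matching e_sym (m := 4 * kappa)) => //; first by lra.
  by move=> v; have /andP[] := hA v.
have [a [s [us sA ps ls]]] := hub_order e_sym x0 e_con domA.
pose c := a :: s; pose pos (i : nat) := nth a c i.
have posA (i : 'I_(size s).+1) : pos i \in A by rewrite -sA mem_nth.
have posS (i : 'I_(size s).+1) : pos (ordS i) \in ball e (pos i) 9.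
  have [ltis|] := ltnP i (size s).
    have := pathP a ps i ltis; rewrite /pos /= modn_small ?ltnS //.
  move=> lesi; have is_ : i = size s :> nat by apply/eqP; rewrite eqn_leq lesi -ltnS ltn_ord.
  by rewrite /pos /= is_ modnn /= -/c /c nth_last.
pose I : finType := ('I_(size s).+1 * bool)%type.
pose g (i : nat) (b : bool) := if b then pos i else f (pos i).
pose src (p : I) := g p.1 p.2.
pose tgt (p : I) := g (ordS p.1) p.2.
have tgt_src p : tgt p \in ball e (src p) 11.
  case: p => i [] /=; rewrite /src /tgt /=; first exact: (subsetP (subset_ball e _ (isT : 9 <= 11)%N)) (posS i).
  have [_ e1] := fB _ (posA i); have [_ e2] := fB _ (posA (ordS i)).
  rewrite e_sym in e1; exact: ball_trans (ball_trans (ball1 e1) (posS i)) (ball1 e2).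
have inner p x' y' : e (src p) x' -> e (tgt p) y' ->
    ball e x' (13 * j) \subset ball e x' k :&: ball e y' k.
  move=> sx ty; rewrite subsetI subset_ball /=; last by rewrite leq_mul2l leqnSn.
  apply/subsetP => z zx; rewrite /k mulnS; apply: ball_trans zx.
  rewrite e_sym in ty; apply: (@ball_trans _ e _ (tgt p) _ 1 12); first exact: ball1.
  apply: (@ball_trans _ e _ (src p) _ 11 1); last exact: ball1.
  exact: (ball_sym e_sym (tgt_src p)).
have slow' x : (#|ball e x k| <= 2 * #|ball e x (13 * j)|)%N.
  by rewrite !(@card_ball_const _ e _ x x0 e_trans).
have ov1 p x' y' : e (src p) x' -> e (tgt p) y' ->
    (#|ball e x' k| <= 2 * #|ball e x' k :&: ball e y' k|)%N.
  move=> sx ty; apply: leq_trans (slow' x') _; rewrite leq_mul2l /=.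
  exact/subset_leq_card/(inner p).
have ov2 p x' y' : e (src p) x' -> e (tgt p) y' ->
    (#|ball e y' k| <= 2 * #|ball e x' k :&: ball e y' k|)%N.
  move=> sx ty; rewrite (@card_ball_const _ e k y' x' e_trans); exact: (ov1 p).
have [U UE] : exists U : {set T}, U = A :|: B by exists (A :|: B).
have sum_pos (h : T -> R) : \sum_(i < (size s).+1) h (pos i) = \sum_(u in A) h u.
  rewrite -(eq_bigl _ _ sA) -big_uniq //= -/c (big_nth a) big_mkord; exact: eq_bigr.
have sum_fpos (h : T -> R) : (forall u, 0 <= h u) ->
    \sum_(i < (size s).+1) h (f (pos i)) <= \sum_(u in B) h u.
  move=> h0; rewrite (sum_pos (h \o f)) /= -(big_imset h fI) /=.
  rewrite [leRHS](bigID (fun u => u \in f @: A)) /= -[leLHS]addr0.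
  apply: lerD; last exact: sumr_ge0.
  rewrite le_eqVlt; apply/orP; left; apply/eqP; apply: eq_bigl => u.
  apply/idP/andP => [uf|[] //]; split=> //.
  by case/imsetP: uf => x xA ->; have [] := fB x xA.
have rR0 : 0 < r := lt_le_trans ltr01 r1.
have load1 v : \sum_(p : I) (hit_nbr R e d k (src p) v + hit_nbr R e d k (tgt p) v) <=
    (32 * r)^-1.
  have h0 u : 0 <= hit_nbr R e d k u v by apply: hit_nbr_ge0.
  have E (h : T -> R) : \sum_(p : I) (h (src p) + h (tgt p)) =
     2 * (\sum_(i < (size s).+1) h (pos i) + \sum_(i < (size s).+1) h (f (pos i))).
    rewrite big_split /= -!(pair_bigA _ (fun (i : 'I_(size s).+1) b => h (g i b))) /=.
    rewrite -(pair_bigA _ (fun (i : 'I_(size s).+1) b => h (g (ordS i) b))) /=.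
    have -> : \sum_(i < (size s).+1) \sum_b h (g (ordS i) b) =
        \sum_(i < (size s).+1) \sum_b h (g i b).
      by rewrite [RHS](reindex_inj (@ordS_inj (size s).+1)).
    by under eq_bigr do rewrite big_bool /=; rewrite big_split /= mulr2n mulrDl !mul1r.
  rewrite (E (fun u => hit_nbr R e d k u v)) (sum_pos (fun u => hit_nbr R e d k u v)).
  have [hs _] := hload v; move: hs.
  rewrite (eq_bigl [predU A & B]); last by move=> u; rewrite in_setU.
  rewrite bigU //= => hs.
  have -> : (32 * r)^-1 = 2 * (64 * r)^-1 by rewrite /r; field; rewrite gt_eqF.
  rewrite ler_pM2l //; apply: le_trans hs; rewrite lerD2l.
  exact: (sum_fpos (fun u => hit_nbr R e d k u v)).
have load2 p : \sum_(u in U) (hit_nbr R e d k (src p) u + hit_nbr R e d k (tgt p) u) <=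
    (32 * r)^-1.
  rewrite big_split UE /=; have [_ h1] := hload (src p); have [_ h2] := hload (tgt p).
  have -> : (32 * r)^-1 = (64 * r)^-1 + (64 * r)^-1 by rewrite /r; field; rewrite gt_eqF.
  exact: lerD.
have rL : 32 * k.+1%:R * (32 * r)^-1 <= 1 :> R by rewrite mulfV // gt_eqF // mulr_gt0.
have [F [FU Fr Fp FD]] := exists_disjoint_routes e_sym e_reg d_gt0 ov1 ov2 rL load1 load2.
have [rt rtP] := boolp.choice (fun p => route_path e_sym (Fp p)).
pose L := hub_ladder a f rt.
exists a, (f a), L, (rt (ord_max, false)), A.
have cnt := count_hub_ladder a f rt.
have fE (i : 'I_(size s).+1) : e (pos i) (f (pos i)) by have [] := fB _ (posA i).
have mem_U u : (u \in c) || (u \in map f c) -> u \in U.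
  rewrite UE in_setU -sA => /orP[-> //|/mapP[x xc ->]].
  have xA : x \in A by rewrite -sA.
  by have [-> _] := fB x xA; rewrite orbT.
have sz p : (size (rt p) <= 2 * k.+1)%N.
  have [_ up sp] := rtP p; rewrite -(card_uniqP up); apply: leq_trans (Fr p).
  by apply: subset_leq_card; apply/subsetP.
split.
- apply: hub_ladderP => i //.
  + by have [] := rtP (i, true).
  + by have [] := rtP (i, false).
- split; first by have := fE ord0.
  rewrite hub_ladder_end; have [+ _ _] := rtP (ord_max, false).
  by rewrite /src /tgt /= /pos modnn /= -[size s]/(size c).-1 nth_last.
- split; last by rewrite hub_ladder_feet.
  apply/uniq_count => x; apply: leq_trans (cnt (pred1 x)) _.
  have c1 : (count_mem x c <= 1)%N by move/uniq_count: us => /(_ x).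
  have uf : uniq (map f c).
    by rewrite map_inj_in_uniq // => u v; rewrite !sA; apply: fI.
  have c2 : (count_mem x (map f c) <= 1)%N by move/uniq_count: uf => /(_ x).
  have c12 : (count_mem x c + count_mem x (map f c) <= 1)%N.
    have [xc|xc] := boolP (x \in c); last first.
      by move: c2; rewrite (count_memPn xc).
    have /count_memPn -> : x \notin map f c; last by rewrite addn0.
    apply/negP => /mapP[y yc xy].
    rewrite sA in yc; rewrite sA in xc; have [xB _] := fB y yc.
    by have := disjointFr dAB xc; rewrite xy xB.
  rewrite pair_bigA (eq_bigr (fun p : I => count_mem x (rt p))); last by case.
  have notF p : x \notin F p -> count_mem x (rt p) = 0%N.
    move=> xF; apply/count_memPn; apply: contra xF.
    by have [_ _] := rtP p; apply.
  have [/existsP[p xp]|/existsPn nF] := boolP [exists p, x \in F p].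
    rewrite (bigD1 p) // big1 ?addn0; last first.
      move=> q /andP[_ qp]; apply: notF; apply/negP => xq.
      by have := disjointFr (FD _ _ qp) xq; rewrite xp.
    have xU : x \notin U.
      by apply/negP => xU; have := disjointFr (FU p) xp; rewrite xU.
    have := contra (@mem_U x) xU; rewrite negb_or => /andP[/count_memPn c0 /count_memPn c0'].
    rewrite -/c c0 c0'.
    have [_ up _] := rtP p; rewrite !add0n [X in (X <= 1)%N]addn0.
    by move/uniq_count: up => /(_ x).
  rewrite big1 ?addn0 //; by move=> p _; apply: notF.
- have szle : (size (a :: f a :: ladder_verts L ++ rt (ord_max, false)) <=
      #|A| * (6 * k.+1))%N.
    rewrite -count_predT; apply: leq_trans (cnt predT) _.
    rewrite !count_predT size_map.
    have cA : #|A| = size c by rewrite -(card_uniqP us); apply: eq_card.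
    have le : (\sum_(i < (size s).+1) \sum_(b : bool) count predT (rt (i, b)) <=
        \sum_(i < (size s).+1) \sum_(b : bool) 2 * k.+1)%N.
      by apply: leq_sum => i _; apply: leq_sum => b _; rewrite count_predT.
    apply: leq_trans (leq_add (leqnn _) le) _.
    rewrite cA /= big_const_ord iter_addn_0 big_bool /=; move: (size s); clear; nia.
  have sumA : d%:R * #|A|%:R <= #|T|%:R * (4 * kappa).
    rewrite -(nbr_count_total R e_sym e_reg A) mulr_natl -sumr_const.
    by apply: ler_sum => v _; have /andP[] := hA v.
  apply: (@le_trans _ _ (#|A|%:R * (6 * r))).
    by rewrite -natrM -natrM ler_nat.
  rewrite -(ler_pM2l d0) [leLHS]mulrA.
  have six0 : 0 <= 6 * r by apply: mulr_ge0; [rewrite ler0n|exact: ltW].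
  apply: le_trans (ler_wpM2r six0 sumA) _.
  rewrite -mulrA [leRHS]mulrA [leRHS]mulrC [d%:R * eta]mulrC; apply: ler_wpM2l; first by rewrite ler0n.
  apply: le_trans heta; rewrite -/KR.
  have h1 : 4 * kappa * (6 * r) <= 4 * (16 * l) * (6 * KR).
    by apply: ler_pM; rewrite ?ler_wpM2l // mulr_ge0 // ltW.
  apply: le_trans h1 _; rewrite le_eqVlt; apply/orP; left; apply/eqP; ring.
- move=> v; have /andP[+ _] := hA v; lra.
Qed.
End Network.

(** * Linear forests and greedy merging *)

Section Forest.
Local Open Scope nat_scope.
Variables (T : finType) (e : rel T).
Hypothesis e_sym : symmetric e.

Definition is_path (p : seq T) : bool := if p is x :: q then path e x q else false.

Lemma is_path_rev p : is_path p -> is_path (rev p).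
Proof.
case: p => // x q /= xq; rewrite lastI rev_rcons /= rev_path.
by rewrite (eq_path (e' := e)) // => u v; rewrite e_sym.
Qed.

Lemma is_path_cat p q x y : is_path (rcons p x) -> is_path (y :: q) -> e x y ->
  is_path (rcons p x ++ y :: q).
Proof.
case: p => [|z p] /=; first by move=> _ -> ->.
by rewrite cat_path last_rcons /= => -> -> ->.
Qed.

Section Matching.
Variables (X : {set T}) (rank : T -> nat) (f : T -> T).

Let arc (B : {set T}) : rel T := [rel x y | (x \in B) && (y == f x)].

Let arc_rank (B : {set T}) x q : {in B, forall u, rank (f u) = (rank u).+1} ->
  path (arc B) x q -> forall y, y \in x :: q -> rank x <= rank y.
Proof.
move=> rf; elim: q x => [|z q IHq] x /=; first by move=> _ y; rewrite inE => /eqP ->.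
case/andP => /andP[xB /eqP zE] zq y; rewrite inE => /orP[/eqP -> //|yq].
by apply: leq_trans (IHq z zq y yq); rewrite zE rf.
Qed.

(** Since [f] raises the rank, the arcs [u -> f u] close no cycle; adding them one by
    one joins two paths each time. *)
Lemma forest_of_matching (B : {set T}) : B \subset X -> {in B &, injective f} ->
  {in B, forall u, [/\ f u \in X, e u (f u) & rank (f u) = (rank u).+1]} ->
  exists ps : seq (seq T), [/\ all is_path ps, uniq (flatten ps), flatten ps =i X
    & size ps + #|B| = #|X|].
Proof.
move=> BX fI fP.
suff [ps [p1 p2 p3 p4]] : exists ps : seq (seq T),
    [/\ all (fun p => if p is x :: q then path (arc B) x q else false) ps,
     uniq (flatten ps), flatten ps =i X & size ps + #|B| = #|X|].
  exists ps; split=> //; apply: sub_all p1 => -[//|x q] /=.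
  by apply: sub_path => u v /andP[uB /eqP ->]; have [] := fP u uB.
have [n] := ubnP #|B|; elim: n B BX fI fP => // n IHn B BX fI fP leB.
have [B0|[u uB]] := set_0Vmem B.
  exists [seq [:: x] | x <- enum X]; split.
  - by apply/allP => p /mapP[x _ ->].
  - by rewrite flatten_map1 map_id enum_uniq.
  - by move=> x; rewrite flatten_map1 map_id mem_enum.
  - by rewrite size_map -cardE B0 cards0 addn0.
pose B' := B :\ u.
have sB' : {subset B' <= B} by move=> x; rewrite inE => /andP[].
have uB' : u \notin B' by rewrite !inE eqxx.
have cB : #|B| = #|B'|.+1 by rewrite (cardsD1 u) uB.
have [||||ps [a1 a2 a3 a4]] := IHn B'.
- by apply/subsetP => x /sB'; apply: subsetP.
- by move=> x y /sB' xB /sB' yB; apply: fI.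
- by move=> x /sB'; apply: fP.
- by rewrite -ltnS -cB.
have uX : u \in X by apply: subsetP uB.
have [vX uv rv] := fP u uB; set v := f u in vX uv rv *.
have /flattenP[p1 p1s up1] : u \in flatten ps by rewrite a3.
have /flattenP[p2 p2s vp2] : v \in flatten ps by rewrite a3.
have [s1 p1E] : exists s1, p1 = rcons s1 u.
  move: (allP a1 p1 p1s); case/splitPr: up1 => s1 [|w s2]; first by exists s1; rewrite cats1.
  have uN (z : T) : arc B' u z = false by rewrite /arc /= (negPf uB').
  by case: s1 => [|x s1]; rewrite /= ?cat_path /= uN ?andbF.
have [s2 p2E] : exists s2, p2 = v :: s2.
  move: (allP a1 p2 p2s); case/splitPr: vp2 => r1 r2.
  case/lastP: r1 => [|r1 w]; first by exists r2.
  suff H : arc B' w v -> False.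
    case: r1 => [|x r1] /=; first by case/andP => /H.
    by rewrite cat_path last_rcons => /andP[_] /= /andP[/H].
  case/andP => wB' /eqP vw; move: uB'; suff -> : u = w by rewrite wB'.
  by apply: fI => //; apply: sB'.
have p12 : p1 != p2.
  apply/eqP => p12; have := allP a1 p2 p2s; rewrite p2E => pv.
  have rf : {in B', forall u, rank (f u) = (rank u).+1}.
    by move=> x /sB' /fP[].
  have := arc_rank rf pv (y := u); rewrite -p2E -p12 up1 rv ltnn.
  by move/(_ isT).
have P1 := perm_to_rem p1s.
have p2r : p2 \in rem p1 ps.
  by move: p2s; rewrite (perm_mem P1) inE eq_sym (negPf p12).
have P2 : perm_eq ps (p1 :: p2 :: rem p2 (rem p1 ps)).
  by apply: perm_trans P1 _; rewrite perm_cons perm_to_rem.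
move: (rem p2 _) P2 => rest P2.
have F2 := perm_flatten P2.
have a1' : all (fun p => if p is x :: q then path (arc B') x q else false) (p1 :: p2 :: rest).
  by rewrite -(perm_all _ P2).
have wid (x : T) q : path (arc B') x q -> path (arc B) x q.
  by apply: sub_path => y z /andP[/sB' yB zf]; apply/andP.
exists ((p1 ++ p2) :: rest); split.
- have uva : arc B u v by rewrite /arc /= uB /v eqxx.
  move: a1' => /= /and3P[h1 h2 h3]; apply/andP; split.
    move: h1 h2; rewrite p1E p2E; case: s1 {p1E} => [|x s1] /= h1 h2.
      by rewrite uva wid.
    by rewrite cat_path last_rcons wid //= uva wid.
  by apply: sub_all h3 => -[//|x q]; apply: wid.
- by move: a2; rewrite (perm_uniq F2) /= catA.
- by move=> x; rewrite -a3 (perm_mem F2) /= catA.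
- by rewrite -a4 (perm_size P2) /= cB !addSn addnS.
Qed.

End Matching.

Section Greedy.
Variables (R : realType) (d : nat) (t : R) (R0 V0 : {set T}) (ps0 : seq (seq T)).
Hypothesis e_reg : regular_graph e d.
Hypothesis t_gt0 : (0 < t)%R.

Let nb v (S : {set T}) : R := (#|[set u in S | e v u]|%:R)%R.

Let nb_mono v (S S' : {set T}) : S \subset S' -> (nb v S <= nb v S')%R.
Proof.
move=> SS'; rewrite ler_nat; apply: subset_leq_card; apply/subsetP => u.
by rewrite !inE => /andP[uS ->]; rewrite (subsetP SS').
Qed.

(** The invariant: every merge uses up one vertex of [R0], and the vertices of [V0] that
    were trimmed off have few free neighbours. *)
Let config (ps : seq (seq T)) (F : {set T}) : Prop :=
  [/\ all is_path ps, uniq (flatten ps),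
      {subset flatten ps <= [predU (flatten ps0) & R0]} /\ F \subset R0,
      {in F, forall v, v \notin flatten ps} /\ size ps + #|R0 :\: F| <= size ps0
    & {in V0, forall v, v \notin flatten ps -> (nb v F < t)%R}].

Let config_perm ps ps' F : perm_eq ps ps' -> config ps F -> config ps' F.
Proof.
move=> P [c1 c2 [c3 c4] [c5 c6] c7]; have PF := perm_flatten P.
split; first by rewrite -(perm_all _ P).
- by rewrite -(perm_uniq PF).
- by split=> // x; rewrite -(perm_mem PF); apply: c3.
- by rewrite -(perm_size P); split=> // v /c5; rewrite (perm_mem PF).
- by move=> v /c7 H; rewrite -(perm_mem PF).
Qed.

Let config_rev p ps F : config (p :: ps) F -> config (rev p :: ps) F.
Proof.
move=> [/= /andP[c0 c1] c2 [c3 c4] [c5 c6] c7].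
have M x : (x \in rev p ++ flatten ps) = (x \in p ++ flatten ps).
  by rewrite !mem_cat mem_rev.
split=> /=.
- by rewrite is_path_rev.
- by rewrite (perm_uniq (s2 := p ++ flatten ps)) // perm_cat2r perm_rev.
- by split=> // x; rewrite M; apply: c3.
- by split=> // v /c5; rewrite M.
- by move=> v /c7 H; rewrite M.
Qed.

Let trim x p ps F : config ((x :: p) :: ps) F -> (nb x F < t)%R ->
  exists2 ps', config ps' F &
    size (flatten ps') + 2 * size ps' < size (flatten ((x :: p) :: ps)) + 2 * (size ps).+1.
Proof.
move=> [/= /andP[c0 c1] /andP[c2' c2] [c3 c4] [c5 c6] c7] nx.
case: p c0 c2 c2' c3 c5 c7 => [|y p] c0 c2 c2' c3 c5 c7.
  exists ps; last by rewrite /=; clear; lia.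
  split=> //.
  - by split=> // v vp; apply: c3; rewrite inE vp orbT.
  - split; last exact: ltnW.
    by move=> v vF; apply: contra (c5 v vF) => vp; rewrite inE vp orbT.
  - move=> v vV vp; have [->//|vx] := eqVneq v x.
    by apply: c7 => //; rewrite inE (negPf vx).
exists ((y :: p) :: ps); last by rewrite /=; clear; lia.
split=> //=.
- by apply/andP; split=> //; case/andP: c0.
- by split=> // v vp; apply: c3; rewrite inE [X in _ || X]vp orbT.
- split=> //.
  by move=> v vF; apply: contra (c5 v vF) => vp; rewrite inE [X in _ || X]vp orbT.
- move=> v vV vp; have [->//|vx] := eqVneq v x.
  by apply: c7 => //; rewrite inE (negPf vx).
Qed.

Let merge p x y q v ps F : config (rcons p x :: (y :: q) :: ps) F ->
  v \in F -> e x v -> e v y -> config ((rcons p x ++ v :: y :: q) :: ps) (F :\ v).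
Proof.
move=> [/= /and3P[c0 c0' c1] c2 [c3 c4] [c5 c6] c7] vF xv vy.
have FR : F :\ v \subset R0 by apply: subset_trans c4; apply: subsetDl.
have M z : (z \in (rcons p x ++ v :: y :: q) ++ flatten ps) =
    (z == v) || (z \in rcons p x ++ y :: q ++ flatten ps).
  by rewrite -catA !mem_cat !inE mem_cat -!orbA orbCA.
split=> /=.
- by rewrite c1 andbT; apply: is_path_cat; rewrite //= vy.
- have P : perm_eq ((rcons p x ++ v :: y :: q) ++ flatten ps)
      (v :: (rcons p x ++ y :: q ++ flatten ps)).
    rewrite -catA; apply/permPl.
    exact: (perm_catCA (rcons p x) [:: v] (y :: q ++ flatten ps)).
  by rewrite (perm_uniq P) /= c2 andbT; apply: c5.
- split=> // z; rewrite M => /orP[/eqP ->|/c3 //].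
  by rewrite inE /= (subsetP c4) ?orbT.
- split.
    by move=> z; rewrite !inE => /andP[zv zF]; rewrite M (negPf zv); apply: c5.
  have -> : R0 :\: (F :\ v) = v |: (R0 :\: F).
    apply/setP => z; rewrite !inE; have [->|] := eqVneq z v => //=.
    by rewrite (subsetP c4).
  by rewrite cardsU1 !inE vF /= addnA addn1; move: c6; rewrite addSn.
- move=> z zV; rewrite M negb_or => /andP[zv zp].
  apply: le_lt_trans (c7 z zV zp); apply: nb_mono; exact: subsetDl.
Qed.

Definition ends (p : seq T) : seq T := if p is x :: q then [:: x; last x q] else [::].

(** Trim every path end with fewer than [t] free neighbours, and join two paths whose
    ends share a free neighbour, as long as possible.  At most [size ps0] vertices
    of the reservoir are used up.  A trimmed vertex of [V0] has lost at least [t] of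
    its neighbours to them, so at most [size ps0 * d / t] such vertices exist. *)
Lemma greedy_merge : all is_path ps0 -> uniq (flatten ps0) ->
  {in R0, forall v, v \notin flatten ps0} -> {subset V0 <= flatten ps0} ->
  {in V0, forall v, (2 * t <= nb v R0)%R} ->
  exists (ps : seq (seq T)) (F : {set T}),
    [/\ all is_path ps, uniq (flatten ps),
        {subset flatten ps <= [predU (flatten ps0) & R0]} /\ F \subset R0,
        {in F, forall v, v \notin flatten ps} /\
          (#|V0|%:R <= (size (flatten ps))%:R + (size ps0)%:R * (d%:R / t))%R
      & {in ps, forall p, {in ends p, forall x, (t <= nb x F)%R}} /\
        {in ps &, forall p q, p != q -> {in ends p & ends q, forall x y,
           {in F, forall v, ~~ (e x v && e v y)}}}].
Proof.
move=> ip0 up0 R0p V0p V0nb.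
have start : config ps0 R0.
  split=> //.
  - by split=> // x xp; rewrite inE /= xp.
  - by rewrite setDv cards0 addn0.
  - by move=> v /V0p ->.
have [ps [F [cfg fin1 fin2]]] : exists ps F, [/\ config ps F,
    {in ps, forall p, {in ends p, forall x, (t <= nb x F)%R}} &
    {in ps &, forall p q, p != q -> {in ends p & ends q, forall x y,
           {in F, forall v, ~~ (e x v && e v y)}}}].
  have [n] := ubnP (size (flatten ps0) + 2 * size ps0).
  move: ps0 R0 start => ps F.
  elim: n ps F => // n IHn ps F cfg lt_n.
  have ipc p : p \in ps -> is_path p by case: cfg => /allP H *; apply: H.
  (* reverse [p] if [x] is its last vertex *)
  have orient p ps' x : config (p :: ps') F -> x \in ends p ->
      exists q, [/\ config ((x :: q) :: ps') F & perm_eq p (x :: q)].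
    case: p => // y q cf; rewrite !inE => /orP[/eqP ->|/eqP xE]; first by exists q.
    have := config_rev cf; rewrite (lastI y q) -xE rev_rcons => cf'.
    exists (rev (belast y q)); split=> //.
    by rewrite -rev_rcons perm_sym perm_rev.
  have [[p [x [pps xp nx]]]|no1] := pselect (exists p x, [/\ p \in ps, x \in ends p & (nb x F < t)%R]).
    have P := perm_to_rem pps.
    have [q [cf Pq]] := orient _ _ _ (config_perm P cfg) xp.
    have [ps' cf' lt'] := trim cf nx.
    apply: IHn cf' _; apply: leq_trans lt' _; rewrite -ltnS; apply: leq_trans lt_n.
    rewrite ltnS (perm_size P) /= (perm_size (perm_flatten P)) /= !size_cat (perm_size Pq).
    by rewrite /= leqnn.
  have [[p [q [x [y [v [[pps qps pq xp yq] [vF xv vy]]]]]]]|no2] := pselect (exists p q x y v,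
     [/\ p \in ps, q \in ps, p != q, x \in ends p & y \in ends q] /\
     [/\ v \in F, e x v & e v y]); last first.
    exists ps, F; split=> //.
      move=> p pps x xp; rewrite leNgt; apply/negP => nx; apply: no1.
      by exists p, x.
    move=> p q pps qps pq x y xp yq v vF; apply/negP => /andP[xv vy].
    by apply: no2; exists p, q, x, y, v.
  have P1 := perm_to_rem pps.
  have qr : q \in rem p ps.
    by move: qps; rewrite (perm_mem P1) inE eq_sym (negPf pq).
  have P2 : perm_eq ps (p :: q :: rem q (rem p ps)).
    by apply: perm_trans P1 _; rewrite perm_cons perm_to_rem.
  move: (rem q _) P2 => rest P2.
  have [p' [cf1 Pp]] := orient _ _ _ (config_perm P2 cfg) xp.
  have swap (a b : seq T) : perm_eq [:: a, b & rest] [:: b, a & rest].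
    by apply/seq.permP => pr /=; rewrite addnCA.
  have cf2 := config_perm (swap _ _) (config_rev cf1).
  have [q' [cf3 Pq]] := orient _ _ _ cf2 yq.
  have cf4 := config_perm (swap _ _) cf3.
  rewrite rev_cons in cf4; have cf5 := merge cf4 vF xv vy.
  apply: IHn cf5 _; rewrite -ltnS; apply: leq_trans lt_n.
  rewrite ltnS (perm_size P2) (perm_size (perm_flatten P2)) /= !size_cat.
  rewrite (perm_size Pp) (perm_size Pq) /= size_rcons size_rev; clear; lia.
case: (cfg) => [c1 c2 [c3 c4] [c5 c6] c7].
exists ps, F; split=> //; split=> //.
pose bad := [set v in V0 | v \notin flatten ps].
have le1 : #|V0| <= size (flatten ps) + #|bad|.
  rewrite -(card_uniqP c2) -(cardsID [set v | v \in flatten ps] V0) leq_add //.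
    by apply: subset_leq_card; apply/subsetP => v; rewrite !inE => /andP[].
  by apply: subset_leq_card; apply/subsetP => v; rewrite !inE andbC.
apply: (@le_trans _ _ ((size (flatten ps))%:R + #|bad|%:R)%R).
  by rewrite -natrD ler_nat.
rewrite lerD2l mulrA ler_pdivlMr //.
apply: (@le_trans _ _ (\sum_(v in bad) nb v (R0 :\: F))%R).
  rewrite mulrC mulr_natr -sumr_const; apply: ler_sum => v; rewrite inE => /andP[vV vp].
  have := c7 v vV vp; have := V0nb v vV.
  suff : (nb v R0 <= nb v F + nb v (R0 :\: F))%R by lra.
  rewrite -natrD ler_nat -(cardsID F [set u in R0 | e v u]) leq_add //.
    by apply: subset_leq_card; apply/subsetP => u; rewrite !inE => /andP[/andP[_ ->] ->].
  by apply: subset_leq_card; apply/subsetP => u; rewrite !inE => /andP[-> /andP[-> ->]].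
apply: (@le_trans _ _ (\sum_v nb v (R0 :\: F))%R).
  rewrite [leRHS](bigID (mem bad)) /= lerDl sumr_ge0 // => v _; exact: ler0n.
rewrite (nbr_count_total R e_sym e_reg) mulrC ler_wpM2r // ler_nat.
by apply: leq_trans c6; apply: leq_addl.
Qed.

End Greedy.
End Forest.

(** * A linear forest with few paths *)

Section BalancedColouring.
Variables (R : realType) (T : finType) (e : rel T) (d : nat).
Hypotheses (e_sym : symmetric e) (e_reg : regular_graph e d).
Let l : R := ln #|T|%:R.

Lemma expR_quadratic (x : R) : 0 <= x -> x <= 2^-1 -> expR x <= 1 + x + 2 * x ^+ 2.
Proof.
move=> x0 x2; have : 1 - x <= (expR x)^-1 by rewrite -expRN expR_ge1Dx.
have e0 := expR_gt0 x => le.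
have {le} : (1 - x) * expR x <= 1 by rewrite -ler_pdivlMr // div1r.
have : (1 - x) * (1 + x + 2 * x ^+ 2) >= 1.
  have -> : (1 - x) * (1 + x + 2 * x ^+ 2) = 1 + x ^+ 2 * (1 - 2 * x) by ring.
  by rewrite lerDl mulr_ge0 ?sqr_ge0 //; lra.
move=> h1 h2; rewrite -(ler_pM2l (_ : 0 < 1 - x)); last by lra.
exact: le_trans h2 h1.
Qed.

Lemma expRN_quadratic (x : R) : 0 <= x -> expR (- x) <= 1 - x + 2 * x ^+ 2.
Proof.
move=> x0; have e0 := expR_gt0 x.
have le := expR_ge1Dx x.
rewrite expRN -(ler_pM2r e0) mulVf ?gt_eqF //.
have q0 : 0 <= 1 - x + 2 * x ^+ 2 by have := sqr_ge0 (x - 2^-1); nra.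
apply: le_trans (ler_wpM2l q0 le).
have -> : (1 - x + 2 * x ^+ 2) * (1 + x) = 1 + x ^+ 2 + 2 * x ^+ 2 * x by ring.
by rewrite -addrA lerDl addr_ge0 ?sqr_ge0 // !mulr_ge0 // sqr_ge0.
Qed.

(** Exponential moments at [theta = eps / 4], the optimal order for a relative
    deviation [eps]. *)
Lemma exists_balanced_colouring (M : finType) (Q : nat) (J : M -> {set 'I_Q.+1}) (eps : R) :
  0 < eps <= 1 -> (forall m, (0 < #|J m|)%N) -> (2 * #|M| < #|T|)%N ->
  16 * Q.+1%:R * l <= eps ^+ 2 * d%:R ->
  exists c : T -> 'I_Q.+1, forall m v,
    let p : R := #|J m|%:R / Q.+1%:R in
    (1 - eps) * (p * d%:R) <= #|[set u in [set u | c u \in J m] | e v u]|%:R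
      <= (1 + eps) * (p * d%:R).
Proof.
move=> /andP[eps0 eps1] J0 MT hd.
have n0 : 0 < #|T|%:R :> R by rewrite ltr0n; apply: leq_ltn_trans MT.
set q : R := Q.+1%:R.
have q0 : 0 < q by rewrite ltr0n.
pose theta : R := eps / 4.
have th0 : 0 < theta by rewrite divr_gt0.
have th2 : theta <= 2^-1 by rewrite /theta; lra.
pose p m : R := #|J m|%:R / q.
have p_ge m : q^-1 <= p m.
  by rewrite -[leLHS]mul1r ler_wpM2r ?invr_ge0 ?(ltW q0) // ler1n.
have pd m : 2 * l <= p m * d%:R * (eps ^+ 2 / 8).
  apply: (@le_trans _ _ (q^-1 * d%:R * (eps ^+ 2 / 8))).
    rewrite -(ler_pM2l (_ : 0 < 8 * q)) ?mulr_gt0 //.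
    have -> : 8 * q * (q^-1 * d%:R * (eps ^+ 2 / 8)) = eps ^+ 2 * d%:R.
      by field; rewrite gt_eqF.
    by apply: le_trans hd; rewrite le_eqVlt; apply/orP; left; apply/eqP; ring.
  by rewrite ler_wpM2r ?divr_ge0 ?sqr_ge0 // ler_wpM2r.
pose J' (i : M * T * bool) := J i.1.1.
pose w (i : M * T * bool) u : R :=
  if i.2 then theta * (e i.1.2 u)%:R else - (theta * (e i.1.2 u)%:R).
pose tau (i : M * T * bool) : R := if i.2 then theta * ((1 + eps) * (p i.1.1 * d%:R))
  else - (theta * ((1 - eps) * (p i.1.1 * d%:R))).
have key m : 2 * theta ^+ 2 * (p m * d%:R) + 2 * l <= theta * eps * (p m * d%:R).
  apply: (@le_trans _ _ (2 * theta ^+ 2 * (p m * d%:R) + p m * d%:R * (eps ^+ 2 / 8))).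
    by rewrite lerD2l.
  by rewrite /theta le_eqVlt; apply/orP; left; apply/eqP; field.
have pd0 m : 0 <= p m * d%:R by rewrite mulr_ge0 // divr_ge0 // ltW.
have [||c hc] := @exists_colouring_unif R T _ Q J' w tau (2 * l).
- rewrite !card_prod card_bool !natrM.
  have -> : expR (- (2 * l)) = (#|T|%:R * #|T|%:R)^-1.
    have -> : 2 * l = l + l by ring.
    by rewrite expRN expRD lnK ?posrE.
  rewrite ltr_pdivrMr ?mulr_gt0 // mul1r mulrAC ltr_pM2r // -natrM ltr_nat mulnC.
  by [].
- case=> -[m v] []; rewrite /J' /w /tau /= -mulr_sumr -/(p m) -/q.
    rewrite (@sum_nbr R T e d e_reg (fun b => expR (theta * b%:R) - 1)); last first.
      by rewrite mulr0 expR0 subrr.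
    rewrite mulr1 -/(p m) mulrA.
    have := ler_wpM2l (pd0 m) (expR_quadratic (ltW th0) th2); have := key m.
    by rewrite !mulrDr; lra.
  rewrite (@sum_nbr R T e d e_reg (fun b => expR (- (theta * b%:R)) - 1)); last first.
    by rewrite mulr0 oppr0 expR0 subrr.
  rewrite mulr1 mulrA.
  have := ler_wpM2l (pd0 m) (expRN_quadratic (ltW th0)); have := key m.
  by rewrite !mulrDr; lra.
exists c => m v /=; rewrite -/(p m).
have inC u : (u \in [set u | c u \in J m]) = (c u \in J m) by rewrite inE.
have := hc (m, v, true); have := hc (m, v, false).
rewrite /J' /w /tau /= sumrN -!mulr_sumr -!(eq_bigl _ _ inC) (sum_card_nbr R e).
rewrite lerN2 !ler_pM2l // => -> ->.
by [].
Qed.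

End BalancedColouring.

Section LinearForest.
Variables (R : realType) (T : finType) (e : rel T) (d : nat).
Hypotheses (e_sym : symmetric e) (e_reg : regular_graph e d).
Let l : R := ln #|T|%:R.
Let n : R := #|T|%:R.

Variables (s : nat) (W : {set T}).
Hypothesis s_ge2 : (2 <= s)%N.
Let K : R := (s ^ 2)%:R.
Let eps : R := (4 * K)^-1.
Hypothesis W_small : #|W|%:R <= eps ^+ 2 / K * n.
Hypothesis T_big : (2 * (s ^ 2).+1 < #|T|)%N.
Hypothesis d_big : 16 * K * l <= eps ^+ 2 * d%:R.
Hypothesis d_gt0 : (0 < d)%N.

(** Use [s ^ 2] colours, the first [s] for the reservoir and the others as layers.
    Between consecutive layers the degrees are [d / K] up to a factor [1 +- eps], so
    Hall's condition fails by at most [3 eps n].  The set [Bd] of the vertices with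
    many neighbours in [W] is small and is left out of the left sides.  The
    number of paths is at most the size of the last layer plus that of [Bd] plus the
    deficiency. *)
Lemma exists_linear_forest : exists (ps : seq (seq T)) (R0 V0 : {set T}),
  [/\ all (is_path e) ps /\ uniq (flatten ps),
      {in W, forall v, v \notin flatten ps} /\ {in R0, forall v, v \notin flatten ps},
      {in R0, forall v, v \notin W} /\ {subset V0 <= flatten ps},
      (size ps)%:R <= 3 * n / K /\ n - 4 * n / s%:R <= #|V0|%:R
    & {in V0, forall v, d%:R / (2 * s%:R) <= #|[set u in R0 | e v u]|%:R :> R}].
Proof.
have [Q QE] : exists Q, (s ^ 2 = Q.+1)%N.
  by exists (s ^ 2).-1; rewrite prednK // expn_gt0; case: s s_ge2.
have sR : 2 <= s%:R :> R by rewrite (ler_nat R 2).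
have sN0 : s%:R != 0 :> R by apply: lt0r_neq0; lra.
have KE : K = s%:R ^+ 2 by rewrite /K natrX.
have K4 : 4 <= K by rewrite KE expr2; nra.
have K0 : 0 < K by lra.
have eps0 : 0 < eps by rewrite invr_gt0 mulr_gt0.
have eK : eps * (4 * K) = 1 by rewrite mulVf // gt_eqF // mulr_gt0.
have eps1 : eps <= 16^-1 by rewrite lef_pV2 ?posrE ?mulr_gt0 //; lra.
have dR : 0 < d%:R :> R by rewrite ltr0n.
have n0 : 0 <= n by [].
pose D : R := d%:R / K.
have D0 : 0 < D by rewrite divr_gt0.
have s_lt : (s <= Q.+1)%N by rewrite -QE -{1}(expn1 s) leq_pexp2l // (leq_trans _ s_ge2).
pose J (m : option 'I_Q.+1) : {set 'I_Q.+1} :=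
  if m is Some j then [set j] else [set j : 'I_Q.+1 | (j < s)%N].
have cJs : #|J None| = s.
  rewrite -[RHS]card_ord -(card_imset _ (f := widen_ord s_lt)).
    apply: eq_card => j; apply/idP/imsetP => [|[i _ ->]]; last by rewrite inE /=.
    rewrite inE => js; by exists (Ordinal js) => //; apply: val_inj.
  by move=> i j /(congr1 val) /= /val_inj.
have J0 m : (0 < #|J m|)%N.
  by case: m => [j|]; [rewrite cards1|rewrite cJs; case: s s_ge2].
have [||||c hc] := @exists_balanced_colouring R T e d e_reg _ Q J eps.
- by rewrite eps0 /=; lra.
- by [].
- by rewrite card_option card_ord -QE.
- by rewrite -QE.
have KQ : Q.+1%:R = K by rewrite /K QE.
rewrite KQ in hc.
pose cls j := [set u | c u == j].
pose low := [set u | (c u < s)%N].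
have clsE j v : [set u in [set u | c u \in J (Some j)] | e v u] = [set u in cls j | e v u].
  by apply/setP => u; rewrite !inE.
have lowE v : [set u in [set u | c u \in J None] | e v u] = [set u in low | e v u].
  by apply/setP => u; rewrite !inE.
have hcls j v : (1 - eps) * D <= #|[set u in cls j | e v u]|%:R <= (1 + eps) * D.
  have := hc (Some j) v; rewrite /= clsE cards1 /D.
  by rewrite [1%:R / K * _]mulrAC mul1r.
have hlow v : (1 - eps) * (s%:R * D) <= #|[set u in low | e v u]|%:R <= (1 + eps) * (s%:R * D).
  have := hc None v; rewrite /= lowE cJs /D.
  by rewrite [s%:R / K * _]mulrAC -mulrA.
have size_of (A : {set T}) (x : R) : (forall v, #|[set u in A | e v u]|%:R <= x) ->
    d%:R * #|A|%:R <= n * x.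
  move=> hA; rewrite -(nbr_count_total R e_sym e_reg A) mulr_natl -sumr_const.
  by apply: ler_sum.
have size_cls j : #|cls j|%:R <= (1 + eps) * n / K.
  rewrite -(ler_pM2l dR); apply: (@le_trans _ _ (n * ((1 + eps) * D))).
    by apply: size_of => v; have /andP[] := hcls j v.
  by rewrite /D le_eqVlt; apply/orP; left; apply/eqP; ring.
have size_low : #|low|%:R <= (1 + eps) * n / s%:R.
  rewrite -(ler_pM2l dR); apply: (@le_trans _ _ (n * ((1 + eps) * (s%:R * D)))).
    by apply: size_of => v; have /andP[] := hlow v.
  by rewrite /D KE le_eqVlt; apply/orP; left; apply/eqP; field; rewrite ?sN0.
pose Bd := [set v | eps * D < #|[set u in W | e v u]|%:R].
have size_Bd : #|Bd|%:R <= eps * n.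
  rewrite -(ler_pM2r (_ : 0 < eps * D)); last exact: mulr_gt0.
  apply: (@le_trans _ _ (d%:R * #|W|%:R)).
    rewrite -(nbr_count_total R e_sym e_reg W) mulr_natl -sumr_const.
    rewrite [leRHS](bigID (mem Bd)) /= -[leLHS]addr0 lerD ?sumr_ge0 //.
    by apply: ler_sum => v; rewrite inE => /ltW.
  apply: le_trans (ler_wpM2l (ltW dR) W_small) _.
  by rewrite /D le_eqVlt; apply/orP; left; apply/eqP; field; rewrite ?sN0.
pose X := [set v | (v \notin W) && (s <= c v)%N].
pose L := [set v in X :\: Bd | (c v < Q)%N].
pose N u := [set v in X | e u v && (c v == (c u).+1 :> nat)].
have hallL (S : {set T}) : S \subset L ->
    (#|S| <= #|\bigcup_(x in S) N x| + Num.truncn (3 * eps * n))%N.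
  move=> SL.
  have le1 : #|S|%:R * ((1 - 2 * eps) * D) <= #|\bigcup_(x in S) N x|%:R * ((1 + eps) * D).
    apply: ler_card_neighbours => [u uS|v].
      have := subsetP SL u uS; rewrite !inE => /andP[/andP[uB /andP[uW su]] uQ].
      rewrite -leNgt in uB.
      have jlt : ((c u).+1 < Q.+1)%N by [].
      have /andP[h _] := hcls (Ordinal jlt) u.
      apply: (@le_trans _ _ (#|[set v in cls (Ordinal jlt) | e u v]|%:R - eps * D)); first by lra.
      rewrite lerBlDr; apply: le_trans (lerD (lexx _) uB); rewrite -natrD ler_nat.
      apply: leq_trans (leq_card_setU _ _); apply: subset_leq_card.
      apply/subsetP => v; rewrite !inE => /andP[/eqP cv uv].
      rewrite uv cv /= eqxx !andbT; case: (v \in W) => //=.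
      by rewrite orbF ltnW // ltnS.
    case E : (c v : nat) => [|j].
      have -> : [set x in S | v \in N x] = set0.
        by apply/setP => u; rewrite !inE E !andbF.
      by rewrite cards0 mulr_ge0 ?addr_ge0 ?(ltW D0) ?(ltW eps0).
    have jlt : (j < Q.+1)%N by rewrite ltnW // -E ltn_ord.
    have /andP[_ h] := hcls (Ordinal jlt) v; apply: le_trans h; rewrite ler_nat.
    apply: subset_leq_card; apply/subsetP => u; rewrite !inE E eqSS => /andP[_ /andP[_ /andP[uv /eqP ju]]].
    by rewrite e_sym uv -val_eqE /= ju eqxx.
  have le2 : #|S|%:R - #|\bigcup_(x in S) N x|%:R <= 3 * eps * n.
    rewrite !(mulrA _ _ D) ler_pM2r // in le1.
    have Sn : #|S|%:R <= n by rewrite ler_nat max_card.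
    have U0 : 0 <= #|\bigcup_(x in S) N x|%:R :> R by [].
    have Un : #|\bigcup_(x in S) N x|%:R <= n by rewrite ler_nat max_card.
    nra.
  rewrite -leq_subLR truncn_ge_nat ?mulr_ge0 ?(ltW eps0) //.
  have [le|/ltnW le] := leqP #|S| #|\bigcup_(x in S) N x|.
    by move: le; rewrite -subn_eq0 => /eqP ->; rewrite !mulr_ge0 // ltW.
  by rewrite natrB.
have [x0 _] : exists x0 : T, x0 \in T.
  by apply/card_gt0P; apply: leq_ltn_trans T_big.
have [B [f [BL cB fI fN]]] := hall_deficient x0 hallL.
have LX : L \subset X by apply/subsetP => v; rewrite !inE => /andP[/andP[_ ->]].
have [||ps [p1 p2 p3 p4]] := @forest_of_matching T e X (fun v => c v) f B _ fI.
- exact: subset_trans BL LX.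
- by move=> u /fN; rewrite inE => /andP[fX /andP[uf /eqP cf]].
exists ps, (low :\: W), (X :\: Bd).
have XW v : v \in X -> v \notin W by rewrite inE => /andP[].
split=> //.
- split=> v; first by move=> vW; rewrite p3; apply: contraL vW => /XW.
  by rewrite p3 !inE => /andP[_ cs]; rewrite leqNgt cs andbF.
- split=> v; first by rewrite inE => /andP[].
  by rewrite p3 => /setDP[].
- have cXL : (#|X| <= #|L| + (#|Bd| + #|cls ord_max|))%N.
    have sub : X \subset L :|: (Bd :|: cls ord_max).
      apply/subsetP => v vX; rewrite inE [v \in L]inE in_setD vX andbT in_setU.
      case: (v \in Bd); rewrite ?orbT //= orbC.
      have := ltn_ord (c v); rewrite ltnS leq_eqVlt => /orP[cQ|->]; last by rewrite orbT.
      by rewrite inE -val_eqE /= cQ.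
    apply: leq_trans (subset_leq_card sub) _; apply: leq_trans (leq_card_setU _ _) _.
    by rewrite leq_add2l leq_card_setU.
  have tr : (Num.truncn (3 * eps * n))%:R <= 3 * eps * n.
    have e3 : 0 <= 3 * eps * n by rewrite !mulr_ge0 // ltW.
    by have /andP[] := truncn_itv e3.
  have sz : (size ps)%:R <= #|Bd|%:R + #|cls ord_max|%:R + 3 * eps * n.
    apply: le_trans (lerD (lexx _) tr); rewrite -!natrD ler_nat.
    by rewrite -(leq_add2r #|B|) p4; apply: leq_trans cXL _; rewrite addnC -!addnA; rewrite !leq_add2l addnC.
  have nK : n / K = 4 * eps * n by rewrite /eps; field; rewrite ?sN0.
  have clsn : #|cls ord_max|%:R <= 4 * eps * n + eps * (n / K).
    apply: le_trans (size_cls _) _; rewrite -nK le_eqVlt; apply/orP; left; apply/eqP; ring.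
  have en0 : 0 <= eps * n by rewrite mulr_ge0 // ltW.
  have nK1 : n / K <= n by rewrite ler_pdivrMr // ler_peMr //; lra.
  have enK : eps * (n / K) <= eps * n by rewrite ler_wpM2l // ltW.
  split.
    by rewrite -[leRHS]mulrA nK; apply: le_trans sz _; lra.
  have cT : (#|T| <= #|W| + (#|low| + (#|Bd| + #|X :\: Bd|)))%N.
    rewrite -[X in (X <= _)%N]cardsT.
    have sub : [set: T] \subset W :|: (low :|: (Bd :|: X :\: Bd)).
      apply/subsetP => v _; rewrite in_setU in_setU in_setU in_setD [v \in X]inE [v \in low]inE.
      by case: (v \in W); case: (v \in Bd); rewrite ?orbT //= ltnNge; case: (_ <= _)%N.
    apply: leq_trans (subset_leq_card sub) _; apply: leq_trans (leq_card_setU _ _) _.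
    rewrite leq_add2l; apply: leq_trans (leq_card_setU _ _) _.
    by rewrite leq_add2l leq_card_setU.
  have cTR : n <= #|W|%:R + (#|low|%:R + (#|Bd|%:R + #|X :\: Bd|%:R)).
    by rewrite -!natrD ler_nat.
  have s0 : 0 < s%:R :> R by lra.
  have ns0 : 0 <= n / s%:R by rewrite divr_ge0 // ltW.
  have W1 : #|W|%:R <= n / s%:R.
    apply: le_trans W_small _; rewrite mulrC ler_wpM2l // ler_pdivrMr //.
    have sK : s%:R^-1 * K = s%:R by rewrite KE expr2 mulKf // gt_eqF.
    by rewrite sK; nra.
  have low1 : #|low|%:R <= n / s%:R + n / s%:R.
    by apply: le_trans size_low _; rewrite -mulrA; nra.
  have eN : eps * n <= n / s%:R.
    rewrite mulrC ler_wpM2l // -[leRHS]mul1r ler_pdivlMr //.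
    have : s%:R <= K by rewrite KE expr2; nra.
    by nra.
  by rewrite -[4 * n / _]mulrA; lra.
- move=> v /setDP[vX vB]; have vW := XW v vX.
  move: vB; rewrite inE -leNgt => vB.
  have /andP[h _] := hlow v.
  have h2 : #|[set u in low | e v u]|%:R <= #|[set u in low :\: W | e v u]|%:R +
      #|[set u in W | e v u]|%:R :> R.
    rewrite -natrD ler_nat; apply: leq_trans (leq_card_setU _ _).
    apply: subset_leq_card; apply/subsetP => u; rewrite !inE => /andP[-> ->].
    by case: (u \in W).
  have s0 : 0 < s%:R :> R by lra.
  have -> : d%:R / (2 * s%:R) = 2^-1 * (s%:R * D).
    by rewrite /D KE; field; rewrite ?sN0.
  have : D * 2 <= s%:R * D by rewrite mulrC ler_wpM2r // ltW.
  have : 0 < s%:R * D by rewrite mulr_gt0.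
  have := ler_wpM2r (ltW D0) eps1.
  have := ler_wpM2r (ltW (mulr_gt0 s0 D0)) eps1.
  rewrite mulrBl mul1r in h.
  by lra.
Qed.

End LinearForest.

(** * Hooking the paths to the ladder *)

Section Attach.
Variables (R : realType) (T : finType) (e : rel T) (d : nat).
Hypotheses (e_sym : symmetric e) (e_reg : regular_graph e d).

Lemma uniq_of_flatten (ps : seq (seq T)) :
  all (is_path e) ps -> uniq (flatten ps) -> uniq ps.
Proof.
elim: ps => //= p ps IHps /andP[pp pps]; rewrite cat_uniq => /and3P[_ np ups].
rewrite IHps // andbT; apply/negP => pin; move/negP: np; apply.
case: p pp pin => // x p _ pin; apply/hasP; exists x; last by rewrite /= inE eqxx.
by apply/flattenP; exists (x :: p); rewrite // inE eqxx.
Qed.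

Lemma perm_hook (I : eqType) (js : seq I) (p : I -> seq T) (v : I * bool -> T) :
  perm_eq (flatten [seq v (i, true) :: rcons (p i) (v (i, false)) | i <- js])
    (flatten [seq p i | i <- js] ++ [seq v x | x <- [seq (i, b) | i <- js, b <- [:: true; false]]]).
Proof.
apply/seq.permP => q; elim: js => //= i js IHjs.
by rewrite -cats1 !count_cat /= IHjs !count_cat /=; lia_count.
Qed.

Variables (A F : {set T}) (ps : seq (seq T)) (t k : R).
Hypotheses (t_ge4 : 4 <= t) (k_gt0 : 0 < k) (tk : 4 * d%:R <= t * k).
Hypothesis A_dense : forall v, k <= #|[set u in A | e v u]|%:R.
Hypotheses (ps_path : all (is_path e) ps) (ps_uniq : uniq (flatten ps)).
Hypothesis F_free : {in F, forall v, v \notin flatten ps}.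
Hypothesis ends_free : {in ps, forall p, {in ends p, forall x,
  t <= #|[set u in F | e x u]|%:R}}.
Hypothesis ends_apart : {in ps &, forall p q, p != q -> {in ends p & ends q,
  forall x y, {in F, forall v, ~~ (e x v && e v y)}}}.

(** Each end owns at least [a >= t / 4] free vertices: ends of different paths share
    none, and the two ends of a path divide theirs.  These vertices have at least
    [k] neighbours in [A] each, while an element of [A] has only [d] neighbours, so
    [a * k >= d] gives Hall's condition. *)
Lemma exists_chords : exists C : seq (chord T),
  [/\ all (is_chord e) C, {subset chord_ends C <= A} /\ uniq (chord_ends C),
      uniq (chord_verts C), {subset flatten ps <= chord_verts C}
    & {subset chord_verts C <= [predU (flatten ps) & F]}].
Proof.
case: ps ps_path ps_uniq F_free ends_free ends_apart => [|p0 ps0].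
  by move=> *; exists [::].
move: (p0 :: ps0) (mem_head p0 ps0) => ps' p0in pp up Ff ef ea.
have [x0 _] : exists x0 : T, x0 \in T.
  by move: (allP pp p0 p0in); case: p0 {p0in} => // x q _; exists x.
pose m := size ps'; pose p (i : 'I_m) := nth [::] ps' i.
have pin i : p i \in ps' by apply: mem_nth.
pose en (i : 'I_m * bool) := if i.2 then head x0 (p i.1) else last x0 (p i.1).
have en_ends i : en i \in ends (p i.1).
  have := allP pp _ (pin i.1); rewrite /en; case: (p i.1) => //= x q _.
  by case: (i.2); rewrite !inE eqxx ?orbT.
pose a := Num.truncn (t / 2).
have t4 := t_ge4; have k0 := k_gt0; have tk4 := tk.
have t20 : 0 <= t / 2 by lra.
have /andP[a_le a_gt] := truncn_itv t20; rewrite -/a in a_le a_gt.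
have a4 : t / 4 <= a%:R by move: a_gt; rewrite -[a.+1%:R]natr1; lra.
pose nF x := [set u in F | e x u].
pose F1 (i : 'I_m) := [set u in take a (enum (nF (en (i, true))))].
pose FF (i : 'I_m * bool) := if i.2 then F1 i.1 else nF (en i) :\: F1 i.1.
have cF1 i : #|F1 i| = a.
  rewrite cardsE (card_uniqP _) ?take_uniq ?enum_uniq // size_take_min; apply/minn_idPl.
  rewrite -cardE -(ler_nat R); apply: le_trans (ef _ (pin i) _ (en_ends (i, true))).
  by lra.
have cFF i : a%:R <= #|FF i|%:R :> R.
  rewrite /FF; case: i => i [] /=; first by rewrite cF1.
  have h := ef _ (pin i) _ (en_ends (i, false)).
  have : #|nF (en (i, false))|%:R <= #|nF (en (i, false)) :\: F1 i|%:R + #|F1 i|%:R :> R.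
    rewrite -natrD ler_nat -(cardsID (F1 i) (nF _)) addnC leq_add2l.
    exact: subset_leq_card (subsetIr _ _).
  rewrite cF1 => h2; apply: (@le_trans _ _ (t - a%:R)); first by lra.
  by rewrite lerBlDr; apply: le_trans h h2.
have FFn i v : v \in FF i -> v \in F /\ e (en i) v.
  rewrite /FF; case: i => i [] /=.
    by rewrite inE => /mem_take; rewrite mem_enum inE => /andP[].
  by rewrite !inE => /andP[_ /andP[]].
have ups := uniq_of_flatten pp up.
have FFd i j v : v \in FF i -> v \in FF j -> i = j.
  move=> vi vj; have [vF ei] := FFn _ _ vi; have [_ ej] := FFn _ _ vj.
  have ij : i.1 = j.1.
    apply/eqP; apply: contraT => nij.
    have npq : p i.1 != p j.1 by rewrite /p nth_uniq.
    have := ea _ _ (pin i.1) (pin j.1) npq _ _ (en_ends i) (en_ends j) v vF.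
    by rewrite ei e_sym ej.
  move: vi vj; rewrite /FF; case: i ij {ei} => i b; case: j {ej} => j c /= ->.
  case: b c => [] [] //= h1 h2; exfalso.
    by case/setDP: h2 => _ /negP[].
  by case/setDP: h1 => _ /negP[].
pose N i := [set u in A | [exists v in FF i, e v u]].
have ak0 : 0 < a%:R * k by rewrite mulr_gt0 //; lra.
have dak : d%:R <= a%:R * k.
  have : t / 4 * k <= a%:R * k by rewrite ler_wpM2r // ltW.
  by lra.
have [S _|f [fI fN]] := @hall _ T x0 N [set: 'I_m * bool].
  rewrite -(ler_nat R) -(ler_pM2r ak0).
  pose V := \bigcup_(i in S) FF i.
  have le1 : #|S|%:R * a%:R <= #|V|%:R * 1 :> R.
    apply: ler_card_neighbours => [i _|v]; first exact: cFF.
    rewrite (ler_nat R _ 1); apply/card_le1_eqP => i j.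
    by rewrite [i \in _]inE [j \in _]inE => /andP[_ vi] /andP[_ vj]; exact: (FFd _ _ _ vj vi).
  have le2 : #|V|%:R * k <= #|\bigcup_(v in V) [set u in A | e v u]|%:R * d%:R.
    apply: ler_card_neighbours => [v _|u]; first exact: A_dense.
    rewrite ler_nat -(e_reg u); apply: subset_leq_card; apply/subsetP => v.
    by rewrite !inE e_sym => /andP[_ /andP[]].
  have le3 : #|\bigcup_(v in V) [set u in A | e v u]|%:R <= #|\bigcup_(i in S) N i|%:R :> R.
    rewrite ler_nat; apply: subset_leq_card; apply/subsetP => u /bigcupP[v /bigcupP[i iS vi]].
    rewrite inE => /andP[uA vu]; apply/bigcupP; exists i => //.
    by rewrite inE uA; apply/existsP; exists v; rewrite vi.
  rewrite mulr1 in le1.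
  rewrite mulrA; apply: (@le_trans _ _ (#|V|%:R * k)); first by rewrite ler_wpM2r // ltW.
  apply: le_trans le2 _; apply: (@le_trans _ _ (#|\bigcup_(i in S) N i|%:R * d%:R)).
    by rewrite ler_wpM2r.
  by rewrite ler_wpM2l.
have fI' : injective f by move=> i j; apply: fI; rewrite inE.
have exv i : exists v, v \in FF i /\ e v (f i).
  have := fN i (in_setT i).
  by rewrite inE => /andP[_ /existsP[v /andP[]]]; exists v.
have [v vP] := boolp.choice exv.
have vI : injective v.
  by move=> i j vij; have [vi _] := vP i; have [vj _] := vP j; apply: (FFd _ _ _ vi); rewrite vij.
have fA i : f i \in A by have := fN i (in_setT i); rewrite inE => /andP[].
pose C : seq (chord T) := [seq ((f (i, true), f (i, false)),
  v (i, true) :: rcons (p i) (v (i, false))) | i <- enum 'I_m].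
pose prs := [seq (i, b) | i <- enum 'I_m, b <- [:: true; false]].
have uprs : uniq prs.
  by apply: allpairs_uniq; rewrite ?enum_uniq // => -[? ?] [? ?] _ _ /= [-> ->].
have endsE : chord_ends C = map f prs.
  rewrite /chord_ends /C /prs map_flatten -!map_comp.
  by congr flatten; apply: eq_map.
have psE : [seq p i | i <- enum 'I_m] = ps'.
  rewrite -[RHS](take_size) -(map_nth_iota0 [::] (leqnn _)) -/m -val_enum_ord -map_comp.
  by [].
have vertsE : perm_eq (chord_verts C) (flatten ps' ++ map v prs).
  by rewrite /chord_verts /C -map_comp -[in X in perm_eq _ X]psE; apply: perm_hook.
exists C; split.
- apply/allP => c /mapP[i _ ->]; rewrite /is_chord /=.
  have [v1 e1] := vP (i, true); have [v2 e2] := vP (i, false).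
  have [_ h1] := FFn _ _ v1; have [_ h2] := FFn _ _ v2.
  rewrite (e_sym (f _)) e1 /= rcons_path last_rcons e2 andbT rcons_path.
  have := allP pp _ (pin i); move: h1 h2; rewrite /en /=; case: (p i) => //= x q h1 h2 ->.
  by rewrite (e_sym (v _)) h1.
- rewrite endsE; split; last by rewrite map_inj_uniq.
  by move=> x /mapP[i _ ->].
- rewrite (perm_uniq vertsE) cat_uniq up map_inj_uniq // uprs andbT /=.
  apply/hasPn => x /mapP[i _ ->]; have [vi _] := vP i; have [vF _] := FFn _ _ vi.
  exact: Ff.
- by move=> x xp; rewrite (perm_mem vertsE) mem_cat xp.
- move=> x; rewrite (perm_mem vertsE) mem_cat inE /= => /orP[->//|/mapP[i _ ->]].
  by have [vi _] := vP i; have [-> _] := FFn _ _ vi; rewrite orbT.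
Qed.

End Attach.

(** * Long cycles *)

Section LongCycle.
Variables (R : realType) (T : finType) (e : rel T) (d s : nat).
Hypotheses (e_simple : simple_graph e) (e_con : connected_graph e).
Hypotheses (e_reg : regular_graph e d) (e_trans : vertex_transitive e).
Let n : R := #|T|%:R.
Let l : R := ln #|T|%:R.
Let K : R := (s ^ 2)%:R.
Let eps : R := (4 * K)^-1.
Let r : R := (13 * (trunc_log 2 #|T|).+1).+1%:R.

(** The linear forest avoids [4 n / s] vertices and the merging, with threshold
    [t = d / (4 s)], loses [(3 n / s ^ 2) * (4 s) = 12 n / s] more. *)
Lemma exists_long_cycle :
  (32 <= s)%N -> (2 * (s ^ 2).+1 < #|T|)%N -> 8 * s%:R <= l ->
  16 * s%:R <= d%:R :> R -> 16 * K * l <= eps ^+ 2 * d%:R ->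
  128 * r ^+ 2 * (274 * l) <= d%:R -> 384 * r * l <= eps ^+ 2 / K * d%:R ->
  exists c : seq T, graph_cycle e c /\ n - 16 * n / s%:R <= (size c)%:R.
Proof.
move=> s32 T_big l_big d16 hd1 hd2 hd3.
have [e_sym e_irr] := e_simple.
have s2 : (2 <= s)%N by apply: leq_trans s32.
have sR : 32 <= s%:R :> R by rewrite (ler_nat R 32).
have sN0 : s%:R != 0 :> R by apply: lt0r_neq0; lra.
have n6 : (6 <= #|T|)%N.
  apply: leq_trans (ltnW T_big); apply: (@leq_trans (2 * s.+1)).
    by apply: (@leq_trans (2 * 3)); rewrite // leq_mul2l /= ltnS.
  by rewrite leq_mul2l ltnS -{1}(expn1 s) leq_pexp2l // (leq_trans _ s2).
have d0 : 0 < d%:R :> R by lra.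
have d_gt0 : (0 < d)%N by rewrite ltr0n in d0.
have l0 : 0 < l by lra.
have [a [b [L [cl [A [lad [eab pcl] [uL feetA] szL A_dense]]]]]] :=
  exists_ladder e_sym e_reg e_trans e_con n6 hd2 hd3.
pose W := [set x in a :: b :: ladder_verts L ++ cl].
have inW x : (x \in W) = (x \in a :: b :: ladder_verts L ++ cl) by rewrite inE.
have W_small : #|W|%:R <= eps ^+ 2 / K * n.
  by apply: le_trans szL; rewrite ler_nat cardsE card_size.
have [ps0 [R0 [V0 [[ip0 up0] [Wp0 R0p0] [R0W V0p] [szps V0n] V0nb]]]] :=
  exists_linear_forest e_sym e_reg s2 W_small T_big hd1 d_gt0.
pose t : R := d%:R / (4 * s%:R).
have s0 : 0 < s%:R :> R by apply: lt_le_trans sR; rewrite ltr0n.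
have t4 : 4 <= t.
  by rewrite ler_pdivlMr ?mulr_gt0 // ?ltr0n //; apply: le_trans d16; rewrite mulrA -[4 * _]natrM lexx.
have t0 : 0 < t by apply: lt_le_trans t4; rewrite ltr0n.
have V0t : {in V0, forall v, 2 * t <= #|[set u in R0 | e v u]|%:R}.
  move=> v /V0nb; apply: le_trans.
  by rewrite /t le_eqVlt; apply/orP; left; apply/eqP; field.
have [ps [F [ip up [sub FR] [Fp szV] [fin1 fin2]]]] :=
  greedy_merge e_sym e_reg t0 ip0 up0 R0p0 V0p V0t.
have k0 : 0 < 2 * l by apply: mulr_gt0; rewrite ?ltr0n.
have tk : 4 * d%:R <= t * (2 * l).
  rewrite /t; have -> : d%:R / (4 * s%:R) * (2 * l) = d%:R * (l / (2 * s%:R)) by field.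
  rewrite mulrC; apply: ler_wpM2l; first exact: ltW.
  by rewrite ler_pdivlMr ?mulr_gt0 // ?ltr0n //; apply: le_trans l_big; rewrite mulrA -[4 * _]natrM lexx.
have [C [isC [CA uCe] uCv pC Cp]] :=
  exists_chords e_sym e_reg t4 k0 tk A_dense ip up Fp fin1 fin2.
have CW x : x \in chord_verts C -> x \notin W.
  move/Cp; rewrite inE /= => /orP[/sub|xF]; last by apply: R0W; apply: (subsetP FR).
  by rewrite inE /= => /orP[xp|/R0W //]; apply: contraL xp => /Wp0.
have cW x : (count_mem x (a :: b :: ladder_verts L ++ cl) + count_mem x (chord_verts C) <= 1)%N.
  have [xW|xW] := boolP (x \in W).
    have : x \notin chord_verts C by apply: contraL xW => /CW.
    by move=> /count_memPn ->; rewrite addn0; move/uniq_count: uL => /(_ x).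
  rewrite inW in xW; move/count_memPn: xW => ->; rewrite add0n.
  by move/uniq_count: uCv => /(_ x).
have [||D [pD lD uD subD Dsub]] := @sweep_ladder T e e_sym L a b b [::] C lad eab isT erefl isC _ uCe.
- by move=> x /CA; rewrite feetA.
- apply/uniq_count => x; have := cW x; have := count_pending x a C.
  by rewrite !count_cat /= !count_cat; lia_count.
exists (b :: D ++ cl).
have size_c : n - 16 * n / s%:R <= (size (b :: D ++ cl))%:R.
  have le1 : (size (flatten ps) <= size (b :: D ++ cl))%N.
    rewrite -cat_cons size_cat; apply: leq_trans (leq_addr _ _).
    by apply: uniq_leq_size up _ => x /pC xC; apply: subD; rewrite cat0s.
  apply: (@le_trans _ _ (size (flatten ps))%:R); last by rewrite ler_nat.
  have : (size ps0)%:R * (d%:R / t) <= 12 * n / s%:R.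
    have -> : d%:R / t = 4 * s%:R by rewrite /t; field; rewrite sN0 gt_eqF.
    have -> : 12 * n / s%:R = 3 * n / K * (4 * s%:R).
      by rewrite /K natrX; field.
    by rewrite ler_wpM2r ?mulr_ge0 // ltW.
  have -> : 16 * n / s%:R = 4 * n / s%:R + 12 * n / s%:R by field.
  by rewrite -/n in V0n szV *; move: V0n szV; rewrite -/n; lra.
split=> //; split; last first.
  rewrite -(ler_nat R); apply: le_trans size_c.
  have n6R : 6 <= n by rewrite (ler_nat R 6).
  have : 16 * n / s%:R <= n / 2.
    by rewrite ler_pdivrMr // mulrAC ler_pdivlMr //; nra.
  by lra.
rewrite /ucycle /= rcons_cat cat_path pD lD pcl /=.
have -> : (b \notin D ++ cl) && uniq (D ++ cl) = uniq (b :: D ++ cl) by [].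
apply/uniq_count => x; have [xD|xD] := boolP (x \in b :: D); last first.
  rewrite -cat_cons count_cat (count_memPn xD) add0n.
  by have := cW x; rewrite /= count_cat; lia_count.
have xcl : x \notin cl.
  apply/negP; rewrite mem_count => xcl; have := cW x; move: xD; rewrite inE.
  case/orP => [/eqP xb|/Dsub].
    by rewrite /= -xb eqxx count_cat; move: xcl; lia_count.
  by rewrite mem_count /= !count_cat; move: xcl; lia_count.
by rewrite -cat_cons count_cat (count_memPn xcl) addn0; move/uniq_count: uD => /(_ x).
Qed.

End LongCycle.


(** * Asymptotics *)

Section Asymptotics.
Variable R : realType.

Lemma trunc_log_le_ln (n : nat) : (0 < n)%N -> (trunc_log 2 n)%:R <= 2 * ln (n%:R : R).
Proof.
move=> n0; have ln2 : 2^-1 <= ln (2 : R).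
  rewrite -(expRK 2^-1) ler_ln ?posrE ?expR_gt0 //.
  by apply: le_trans (expR_le_1D2x _ _) _; lra.
have : ln (2 ^ trunc_log 2 n)%:R <= ln (n%:R : R).
  by rewrite ler_ln ?posrE ?ltr0n ?expn_gt0 // ler_nat trunc_logP.
rewrite natrX lnXn // -[ln _ *+ _]mulr_natl => le; have t0 : 0 <= (trunc_log 2 n)%:R :> R by [].
by have := ler_wpM2l t0 ln2; lra.
Qed.

Lemma little_omega_ge (f : nat -> R) (C : R) :
  little_omega f (fun n : nat => ln (n%:R : R) ^+ 3 * ln (ln (n%:R : R))) -> 0 < C ->
  exists N, forall n, (N <= n)%N -> 4 <= ln (n%:R : R) ->
    C * ln (n%:R : R) ^+ 3 <= f n.
Proof.
move=> hf C0.
have [N _ HN] : \forall n \near \oo%classic, C <= f n / (ln (n%:R : R) ^+ 3 * ln (ln (n%:R : R))).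
  by move/cvgryPge: hf => /(_ C).
exists N => n Nn l4; have := HN n Nn; move: (ln n%:R) l4 => l l4 /=.
have l3 : 0 < l ^+ 3 by rewrite exprn_gt0 //; lra.
have ll : 1 <= ln l.
  rewrite -(expRK 1) ler_ln ?posrE ?expR_gt0 //; last by lra.
  exact: le_trans (expR1_le4 R) l4.
rewrite ler_pdivlMr; last by rewrite mulr_gt0 //; lra.
apply: le_trans; rewrite ler_wpM2l ?ler_peMr // ltW //.
Qed.

Lemma ln_ge (x : R) (n : nat) : ((Num.truncn (expR x)).+1 <= n)%N -> x <= ln (n%:R : R).
Proof.
move=> le; have n0 : 0 < n%:R :> R by rewrite ltr0n; apply: leq_trans le.
rewrite -(expRK x) ler_ln ?posrE ?expR_gt0 //.
have /andP[_ lt] := truncn_itv (expR_ge0 x).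
by apply: le_trans (ltW lt) _; rewrite ler_nat.
Qed.

End Asymptotics.

Theorem theorem1p8 (R : realType) (f : nat -> R)
    (hf : little_omega f (fun n : nat => ln (n%:R : R) ^+ 3 * ln (ln (n%:R : R))))
    (delta : R) (hdelta : 0 < delta) :
  exists N : nat, forall (T : finType) (e : rel T) (d : nat),
    simple_graph e -> connected_graph e -> regular_graph e d ->
    vertex_transitive e ->
    (N <= #|T|)%N -> f #|T| <= d%:R ->
    exists c : seq T,
      graph_cycle e c /\ (1 - delta) * #|T|%:R <= (size c)%:R.
Proof.
pose s := (32 + (Num.truncn (16 / delta)).+1)%N.
have s32 : (32 <= s)%N by apply: leq_addr.
have sR : 32 <= s%:R :> R by rewrite (ler_nat R 32).
have s0 : 0 < s%:R :> R by apply: lt_le_trans sR.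
have s_delta : 16 / s%:R <= delta.
  rewrite ler_pdivrMr // -ler_pdivrMl // mulrC.
  have /andP[_ lt] := truncn_itv (divr_ge0 (ler0n R 16) (ltW hdelta)).
  by apply: le_trans (ltW lt) _; rewrite ler_nat /s leq_addl.
pose K : R := (s ^ 2)%:R; pose eps : R := (4 * K)^-1.
have K0 : 0 < K by rewrite ltr0n expn_gt0.
have eps0 : 0 < eps by rewrite invr_gt0 mulr_gt0.
pose c1 : R := 16 * s%:R.
pose c2 : R := 16 * K / eps ^+ 2.
pose c3 : R := 128 * 40 ^+ 2 * 274.
pose c4 : R := 384 * 40 * K / eps ^+ 2.
have c1_gt0 : 0 < c1 by apply: mulr_gt0.
have c2_gt0 : 0 < c2 by apply: divr_gt0; [apply: mulr_gt0|apply: exprn_gt0].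
have c3_gt0 : 0 < c3.
  apply: mulr_gt0; last by rewrite ltr0n.
  by apply: mulr_gt0; [rewrite ltr0n|apply: exprn_gt0; rewrite ltr0n].
have c4_gt0 : 0 < c4.
  apply: divr_gt0; last exact: exprn_gt0.
  by apply: mulr_gt0; [apply: mulr_gt0; rewrite ltr0n|exact: K0].
have C0 : 0 < c1 + c2 + c3 + c4 by rewrite !addr_gt0.
have [N1 HN1] := little_omega_ge hf C0.
exists (maxn N1 (maxn (Num.truncn (expR (8 * s%:R : R))).+1 (2 * (s ^ 2).+1).+1)).
move=> T e d simp con reg trans; rewrite !geq_max => /and3P[nN1 nN2 nN3] fd.
have l_big := ln_ge nN2; set l : R := ln #|T|%:R in l_big *.
have l1 : 1 <= l by apply: le_trans l_big; apply: le_trans (ler_wpM2l (ler0n R 8) sR); rewrite -natrM ler1n.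
have l4 : 4 <= l by apply: le_trans l_big; apply: le_trans (ler_wpM2l (ler0n R 8) sR); rewrite -natrM ler_nat.
have l0 : 0 < l by apply: lt_le_trans l1.
have dC : (c1 + c2 + c3 + c4) * l ^+ 3 <= d%:R by apply: le_trans (HN1 _ nN1 l4) fd.
have p1 : 0 <= c1 * l ^+ 3 by rewrite mulr_ge0 ?exprn_ge0 // ltW.
have p2 : 0 <= c2 * l ^+ 3 by rewrite mulr_ge0 ?exprn_ge0 // ltW.
have p3 : 0 <= c3 * l ^+ 3 by rewrite mulr_ge0 ?exprn_ge0 // ltW.
have p4 : 0 <= c4 * l ^+ 3 by rewrite mulr_ge0 ?exprn_ge0 // ltW.
have [d1 d2 d3 d4] : [/\ c1 * l ^+ 3 <= d%:R, c2 * l ^+ 3 <= d%:R,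
    c3 * l ^+ 3 <= d%:R & c4 * l ^+ 3 <= d%:R].
  by rewrite !mulrDl in dC; move: (c1 * _) (c2 * _) (c3 * _) (c4 * _) p1 p2 p3 p4 dC
    => x y z w *; split; lra.
have ll3 : l <= l ^+ 3 by rewrite -[leLHS]expr1 ler_weXn2l.
have l2l3 : l ^+ 2 <= l ^+ 3 by rewrite ler_weXn2l.
have l3 : 1 <= l ^+ 3 by rewrite exprn_ege1.
have n0 : (0 < #|T|)%N by apply: leq_ltn_trans nN3.
pose r : R := (13 * (trunc_log 2 #|T|).+1).+1%:R.
have r40 : r <= 40 * l.
  have := trunc_log_le_ln R n0; rewrite -/l => le.
  by rewrite /r -[(13 * _).+1%:R]natr1 natrM -[(trunc_log _ _).+1%:R]natr1; lra.
have r0 : 0 <= r by apply: ler0n.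
(* the four constants [c1], ..., [c4] serve the four conditions on [d], in this order *)
have [||||c [cyc len]] := @exists_long_cycle R T e d s simp con reg trans s32 nN3 l_big.
- by apply: le_trans d1; rewrite -/c1 ler_peMr // ltW.
- rewrite -/K -/eps -/l; apply: (@le_trans _ _ (eps ^+ 2 * (c2 * l ^+ 3))).
    have -> : eps ^+ 2 * (c2 * l ^+ 3) = 16 * K * l ^+ 3.
      by rewrite /c2; field; rewrite gt_eqF.
    by rewrite ler_wpM2l // mulr_ge0 // ltW.
  by rewrite ler_wpM2l // exprn_ge0 // ltW.
- rewrite -/r -/l; apply: le_trans d3.
  have -> : c3 * l ^+ 3 = 128 * (40 * l) ^+ 2 * (274 * l) by rewrite /c3; ring.
  apply: ler_wpM2r; first by apply: mulr_ge0; [rewrite ler0n|exact: ltW].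
  by apply: ler_wpM2l; [rewrite ler0n|apply: lerXn2r; rewrite ?nnegrE // mulr_ge0 // ltW].
- rewrite -/K -/eps -/r -/l; apply: (@le_trans _ _ (eps ^+ 2 / K * (c4 * l ^+ 3))).
    have -> : eps ^+ 2 / K * (c4 * l ^+ 3) = 384 * 40 * l ^+ 3.
      by rewrite /c4; field; rewrite !gt_eqF.
    apply: (@le_trans _ _ (384 * (40 * l) * l)).
      by apply: ler_wpM2r; [exact: ltW|apply: ler_wpM2l; [rewrite ler0n|exact: r40]].
    have -> : 384 * (40 * l) * l = 384 * 40 * l ^+ 2 by ring.
    by apply: ler_wpM2l; [apply: mulr_ge0; rewrite ler0n|exact: l2l3].
  by rewrite ler_wpM2l // divr_ge0 ?exprn_ge0 // ltW.
exists c; split=> //; apply: le_trans len.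
rewrite mulrBl mul1r lerB // mulrAC ler_wpM2r //.
Qed.
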